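(* For every $t\ge0$ let $A(t)$ be a real symmetric $n\times n$ matrix indexed by $V$ such that its Laplacian matrix $L(t)$ depends analytically on $t$, and let $\mathbb{L}(t)$ be the associated $p$-adic Laplacian on $L^2(K_N,\mathbb{C})$. Let $U(t,s)$ be the evolution family of $\frac{\partial u}{\partial t}=\mathbb{L}(t)u$, and for $m\in\mathbb{N}$ let $$U_m(t,s)=e^{\frac{t-s}{m}\mathbb{L}(t)}\cdots e^{\frac{t-s}{m}\mathbb{L}\left(s+2\frac{t-s}{m}\right)}e^{\frac{t-s}{m}\mathbb{L}\left(s+\frac{t-s}{m}\right)}$$ be the temporal discretisation with $m$ time points. Then for all $t\ge s\ge0$ and $u_0\in L^2(K_N,\mathbb{C})$ the approximation error satisfies $$\|U_m(t,s)u_0-U(t,s)u_0\|_{L^2}=O\left(\frac1m e^{\frac1m}\right)\qquad (m\to\infty).$$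
   Context: $p$ is a prime, $\mathbb{Q}_p$ the $p$-adic numbers with absolute value $|\cdot|_p$, $dx$ the Haar measure with $\int_{\mathbb{Z}_p}dx=1$. $V\subset\mathbb{Q}_p$ is a set of $n$ points of the form $I=I_0+\dots+I_{N-1}p^{N-1}$, $I_i\in\{0,\dots,p-1\}$, with $N$ fixed so that the balls $B_{p^{-N}}(I)=\{x:|x-I|_p\le p^{-N}\}$, $I\in V$, are pairwise disjoint; $K_N=\bigsqcup_{I\in V}B_{p^{-N}}(I)$, and $\Omega_{I,N}$ is the indicator function of $B_{p^{-N}}(I)$. Put $\gamma_I(t)=\sum_{J\in V}A_{IJ}(t)$, $L(t)=A(t)-(\gamma_I(t)\delta_{IJ})_{I,J}$, and $$\mathbb{L}(t)u(x)=\int_{K_N}p^N\sum_{I,J\in V}A_{IJ}(t)\Omega_{I,N}(x)\Omega_{J,N}(y)\,u(y)\,dy-\Big(\sum_{I\in V}\gamma_I(t)\Omega_{I,N}(x)\Big)u(x).$$ The evolution family $U(t,s)$, $t\ge s\ge0$, is the family of bounded operators such that $t\mapsto U(t,s)u_0$ is the unique (strict, $C^1$) solution of $\frac{\partial u}{\partial t}=\mathbb{L}(t)u$ with $u(s)=u_0$.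
   Formalization: The diagonal entries A_II(t) are also assumed analytic in t (automatic if A_II=0): they cancel in the Laplacian matrix L(t) but not in the p-adic Laplacian, and without this the error bound fails, e.g. for n=1 and A(t) continuous but rough. *)

(* Defs.v *)
From HB Require Import structures.
From mathcomp Require Import all_boot all_order all_algebra complex.
From mathcomp Require Import ring_quotient.
From mathcomp Require Import zify ring lra.
From mathcomp Require Import all_classical all_reals all_analysis.
From mathcomp Require Import measurable_realfun.
Set Implicit Arguments.
Unset Strict Implicit.
Unset Printing Implicit Defensive.
Import Order.TTheory GRing.Theory Num.Theory.
Import numFieldNormedType.Exports.
Local Open Scope classical_set_scope.
Local Open Scope ring_scope.

Definition padic_val (p : nat) (x : rat) : int :=
  (logn p `|numq x|%N)%:Z - (logn p `|denq x|%N)%:Z.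

Definition padic_abs (p : nat) (x : rat) : rat :=
  if x == 0 then 0 else p%:R ^ (- padic_val p x).

Section PadicAbs.
Variables (p : nat) (p_pr : prime p).
Local Notation val := (padic_val p).
Local Notation abs := (padic_abs p).

Let p_gt0 : (0 : rat) < p%:R. Proof. by rewrite ltr0n prime_gt0. Qed.
Let p_neq0 : (p%:R : rat) != 0. Proof. by rewrite gt_eqF. Qed.
Let p_gt1 : (1 : rat) < p%:R. Proof. by rewrite ltr1n prime_gt1. Qed.

Lemma padic_val_frac (a b : int) : a != 0 -> b != 0 ->
  val (a%:Q / b%:Q) = (logn p `|a|%N)%:Z - (logn p `|b|%N)%:Z.
Proof.
move=> a0 b0; set x := _ / _.
have x0 : x != 0 by rewrite mulf_neq0 ?invr_eq0 ?intr_eq0.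
have : (numq x * b)%:Q = (a * denq x)%:Q.
  rewrite !rmorphM/= numqE /x; field; rewrite intr_eq0//.
move/eqP; rewrite eqr_int => /eqP /(congr1 absz); rewrite !abszM.
move/(congr1 (logn p)); rewrite !lognM ?absz_gt0 ?numq_eq0 ?denq_neq0// => e.
by rewrite /padic_val -/x; lia.
Qed.

Lemma padic_valM (x y : rat) : x != 0 -> y != 0 -> val (x * y) = val x + val y.
Proof.
move=> x0 y0; rewrite -{1}(divq_num_den x) -{1}(divq_num_den y).
have -> : (numq x)%:Q / (denq x)%:Q * ((numq y)%:Q / (denq y)%:Q) =
   (numq x * numq y)%:Q / (denq x * denq y)%:Q.
  by rewrite !rmorphM/= invfM; ring.
rewrite padic_val_frac ?mulf_neq0 ?numq_eq0 ?denq_neq0//.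
by rewrite !abszM !lognM ?absz_gt0 ?numq_eq0 ?denq_neq0// /padic_val; lia.
Qed.

Lemma padic_abs0 : abs 0 = 0. Proof. by rewrite /padic_abs eqxx. Qed.

Lemma padic_absM (x y : rat) : abs (x * y) = abs x * abs y.
Proof.
rewrite /padic_abs mulf_eq0.
have [_|x0]/= := eqVneq x 0; first by rewrite mul0r.
have [_|y0]/= := eqVneq y 0; first by rewrite mulr0.
by rewrite padic_valM// opprD expfzDr.
Qed.

Lemma padic_abs_gt0 (x : rat) : (0 < abs x) = (x != 0).
Proof.
by rewrite /padic_abs; case: eqVneq => [_|x0]; rewrite ?ltxx// exprz_gt0.
Qed.

Lemma padic_abs_ge0 (x : rat) : 0 <= abs x.
Proof.
by rewrite /padic_abs; case: eqVneq => // _; rewrite exprz_ge0// ltW.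
Qed.

Lemma padic_abs_eq0 (x : rat) : (abs x == 0) = (x == 0).
Proof.
apply/idP/idP => [/eqP e|/eqP->]; last by rewrite padic_abs0.
by apply/negPn/negP; rewrite -padic_abs_gt0 e ltxx.
Qed.

Lemma padic_abs1 : abs 1 = 1.
Proof.
have := padic_absM 1 1; rewrite mulr1 => /esym/eqP.
rewrite -subr_eq0 -[X in _ - X]mulr1 -mulrBr mulf_eq0 padic_abs_eq0 oner_eq0/=.
by rewrite subr_eq0 => /eqP.
Qed.

Lemma padic_absN (x : rat) : abs (- x) = abs x.
Proof.
by rewrite /padic_abs oppr_eq0 /padic_val numqN denqN abszN.
Qed.

Lemma padic_absV (x : rat) : abs x^-1 = (abs x)^-1.
Proof.
have [->|x0] := eqVneq x 0; first by rewrite !(invr0, padic_abs0).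
apply: (@mulfI _ (abs x)); first by rewrite padic_abs_eq0.
by rewrite -padic_absM !divff ?padic_abs_eq0// padic_abs1.
Qed.

Lemma padic_val_int (a : int) (k : nat) : a != 0 ->
  ((p ^ k) %| `|a|)%N = (k%:Z <= val a%:Q).
Proof.
move=> a0; have := @padic_val_frac a 1 a0 isT.
rewrite divr1 /= => ->; rewrite logn1 subr0.
by rewrite pfactor_dvdn ?absz_gt0.
Qed.

Lemma padic_absD_int (a b : int) :
  abs (a + b)%:Q <= Num.max (abs a%:Q) (abs b%:Q).
Proof.
have [->|a0] := eqVneq a 0.
  by rewrite add0r le_max lexx orbT.
have [->|b0] := eqVneq b 0.
  by rewrite addr0 le_max lexx.
have [->|ab0] := eqVneq (a + b) 0.
  by rewrite padic_abs0 le_max padic_abs_ge0.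
rewrite le_max /padic_abs !intr_eq0 (negPf a0) (negPf b0) (negPf ab0).
rewrite !ler_eXz2l// !lerN2.
have e1 (c : int) : val c%:Q = (logn p `|c|%N)%:Z.
  have [->|c0] := eqVneq c 0.
    by rewrite /padic_val/= lognE /= andbF logn1.
  by have := @padic_val_frac c 1 c0 isT; rewrite divr1 /= => ->; rewrite logn1 subr0.
have H k : k%:Z <= val a%:Q -> k%:Z <= val b%:Q -> k%:Z <= val (a + b)%:Q.
  rewrite -!padic_val_int// => ha hb.
  have: ((p ^ k)%:Z %| a + b)%Z by rewrite rpredD // unfold_in /= dvdzE.
  by rewrite dvdzE.
rewrite !e1 in H *.
case: (leqP (logn p `|a|%N) (logn p `|b|%N)) => h.
  by apply/orP; left; apply: H; lia.
by apply/orP; right; apply: H; lia.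
Qed.

Lemma padic_absD (x y : rat) : abs (x + y) <= Num.max (abs x) (abs y).
Proof.
have dx : (denq x)%:Q != 0 by rewrite intr_eq0 denq_neq0.
have dy : (denq y)%:Q != 0 by rewrite intr_eq0 denq_neq0.
pose d := (denq x * denq y)%:Q.
have d0 : 0 < abs d by rewrite padic_abs_gt0 intr_eq0 mulf_neq0 ?denq_neq0.
rewrite -(ler_pM2l d0) maxr_pMr; last exact: ltW.
rewrite -!padic_absM.
have -> : d * (x + y) = (numq x * denq y + numq y * denq x)%:Q.
  rewrite /d !rmorphD !rmorphM/= !numqE; ring.
have -> : d * x = (numq x * denq y)%:Q.
  by rewrite /d !rmorphM/= !numqE; ring.
have -> : d * y = (numq y * denq x)%:Q.
  by rewrite /d !rmorphM/= !numqE; ring.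
exact: padic_absD_int.
Qed.

Lemma padic_absD_eq (x y : rat) : abs y < abs x -> abs (x + y) = abs x.
Proof.
move=> yx; apply/eqP; rewrite eq_le; apply/andP; split.
  by rewrite (le_trans (padic_absD _ _))// ge_max lexx ltW.
have := padic_absD (x + y) (- y); rewrite addrK padic_absN le_max.
by case/orP => // /(lt_le_trans yx); rewrite ltxx.
Qed.

Lemma padic_abs_le_add (x y : rat) : abs (x + y) <= abs x + abs y.
Proof.
apply: (le_trans (padic_absD x y)).
by rewrite ge_max lerDl lerDr !padic_abs_ge0.
Qed.

End PadicAbs.

Definition padic_cauchy (p : nat) (u : nat -> rat) : Prop :=
  forall e : rat, 0 < e ->
    exists N, forall m n, (N <= m)%N -> (N <= n)%N -> padic_abs p (u m - u n) < e.

Definition padic_null (p : nat) (u : nat -> rat) : Prop :=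
  forall e : rat, 0 < e ->
    exists N, forall n, (N <= n)%N -> padic_abs p (u n) < e.

Definition padic_cauchyb (p : nat) (p_pr : prime p) : {pred nat -> rat} :=
  mem [set u | padic_cauchy p u].

Record padic_seq (p : nat) (p_pr : prime p) :=
  PadicSeq { padic_seq_val :> nat -> rat;
             padic_seqP : padic_seq_val \in padic_cauchyb p_pr }.

Section PadicSeq.
Variables (p : nat) (p_pr : prime p).
Local Notation abs := (padic_abs p).
Implicit Types u v : nat -> rat.

Lemma padic_cauchybP u : reflect (padic_cauchy p u) (u \in padic_cauchyb p_pr).
Proof. by apply: (iffP idP) => [/set_mem//|h]; apply/mem_set. Qed.

Lemma padic_cauchy_bounded u : padic_cauchy p u ->
  exists2 M, 0 < M & exists N, forall n, (N <= n)%N -> abs (u n) <= M.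
Proof.
move=> /(_ 1 ltr01)[N h]; exists (abs (u N) + 1).
  by rewrite ltr_wpDl ?padic_abs_ge0.
exists N => n Nn; rewrite -[u n](subrK (u N)) addrC.
apply: (le_trans (padic_abs_le_add p_pr _ _)).
by rewrite lerD2l ltW// h.
Qed.

Lemma padic_cauchy_subring : subring_closed (padic_cauchyb p_pr).
Proof.
split.
- apply/padic_cauchybP => e e0; exists 0%N => m n _ _.
  by rewrite subrr padic_abs0.
- move=> u v /padic_cauchybP cu /padic_cauchybP cv; apply/padic_cauchybP => e e0.
  have [N hN] := cu _ e0; have [M hM] := cv _ e0.
  exists (maxn N M) => m n; rewrite !geq_max => /andP[Nm Mm] /andP[Nn Mn].
  have -> : (u - v) m - (u - v) n = (u m - u n) + (v n - v m).
    by change (u m - v m - (u n - v n) = u m - u n + (v n - v m)); ring.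
  apply: (le_lt_trans (padic_absD p_pr _ _)); rewrite gt_max hN//= hM//.
- move=> u v /padic_cauchybP cu /padic_cauchybP cv; apply/padic_cauchybP => e e0.
  have [A A0 [NA hA]] := padic_cauchy_bounded cu.
  have [B B0 [NB hB]] := padic_cauchy_bounded cv.
  have [N hN] := cu _ (divr_gt0 e0 B0); have [M hM] := cv _ (divr_gt0 e0 A0).
  exists (maxn (maxn NA NB) (maxn N M)) => m n.
  rewrite !geq_max => /andP[/andP[NAm NBm] /andP[Nm Mm]].
  move=> /andP[/andP[NAn NBn] /andP[Nn Mn]].
  have -> : (u * v) m - (u * v) n = u m * (v m - v n) + (u m - u n) * v n.
    by change (u m * v m - u n * v n = u m * (v m - v n) + (u m - u n) * v n); ring.
  apply: (le_lt_trans (padic_absD p_pr _ _)); rewrite gt_max; apply/andP; split.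
    rewrite padic_absM//; apply: (@le_lt_trans _ _ (A * abs (v m - v n))).
      by rewrite ler_wpM2r ?padic_abs_ge0// hA.
    by rewrite mulrC -ltr_pdivlMr// hM.
  rewrite padic_absM//; apply: (@le_lt_trans _ _ (abs (u m - u n) * B)).
    by rewrite ler_wpM2l ?padic_abs_ge0// hB.
  by rewrite -ltr_pdivlMr// hN.
Qed.

HB.instance Definition _ :=
  GRing.isSubringClosed.Build (nat -> rat) (padic_cauchyb p_pr)
    padic_cauchy_subring.

HB.instance Definition _ := [isSub for @padic_seq_val p p_pr].
HB.instance Definition _ := [Choice of padic_seq p_pr by <:].
HB.instance Definition _ := [SubChoice_isSubComNzRing of padic_seq p_pr by <:].

Definition padic_nullb : {pred padic_seq p_pr} :=
  fun u : padic_seq p_pr => `[< padic_null p u >].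

Lemma padic_nullbP (u : padic_seq p_pr) :
  reflect (padic_null p u) (u \in padic_nullb).
Proof. exact: asboolP. Qed.

Lemma padic_null_ideal : idealr_closed padic_nullb.
Proof.
split.
- by apply/padic_nullbP => e e0; exists 0%N => n _; rewrite padic_abs0.
- apply/padic_nullbP => /(_ 1 ltr01)[N /(_ N (leqnn _))].
  by rewrite (padic_abs1 p_pr) ltxx.
- move=> a u v /padic_nullbP nu /padic_nullbP nv; apply/padic_nullbP => e e0.
  have [A A0 [NA hA]] := padic_cauchy_bounded (padic_cauchybP _ (padic_seqP a)).
  have [N hN] := nu _ (divr_gt0 e0 A0); have [M hM] := nv _ e0.
  exists (maxn NA (maxn N M)) => n; rewrite !geq_max => /andP[NAn /andP[Nn Mn]].
  apply: (le_lt_trans (padic_absD p_pr _ _)); rewrite gt_max hM// andbT.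
  rewrite padic_absM//; apply: (@le_lt_trans _ _ (A * abs (u n))).
    by rewrite ler_wpM2r ?padic_abs_ge0// hA.
  by rewrite mulrC -ltr_pdivlMr// hN.
Qed.

HB.instance Definition _ := isIdealr.Build (padic_seq p_pr) padic_nullb
  padic_null_ideal.

End PadicSeq.

(* Q_p is the completion of (rat, padic_abs p): Cauchy sequences of rationals
   modulo null sequences. It is a field, and its absolute value padic_norm takes
   its values in rat. *)
Definition padic (p : nat) (p_pr : prime p) : Type :=
  {ideal_quot (padic_nullb (p_pr := p_pr))}.

Section PadicRing.
Variables (p : nat) (p_pr : prime p).
Local Notation padic := (padic p_pr).
HB.instance Definition _ := GRing.ComNzRing.on padic.
End PadicRing.

Section PadicNorm.
Local Open Scope quotient_scope.
Variables (p : nat) (p_pr : prime p).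
Local Notation abs := (padic_abs p).
Local Notation padic := (padic p_pr).
Implicit Types x y : padic.

Definition padic_rat (q : rat) : padic :=
  \pi_(padic : Type) (insubd (0 : padic_seq p_pr) (fun=> q)).

(* If x is the class of u then |x|_p = lim |u n|_p. The sequence |u n|_p is
   eventually constant unless u is null, in which case the limit 0 is covered by
   the default value of xget. *)
Definition padic_norm x : rat :=
  xget 0 [set c | exists N, forall n, (N <= n)%N -> abs (repr x n) = c].

Definition padic_seq_inv (u : padic_seq p_pr) : padic_seq p_pr :=
  insubd 0 (fun n => (u n)^-1).

Definition padic_inv x : padic :=
  if x == 0 then 0 else \pi_(padic : Type) (padic_seq_inv (repr x)).

Lemma padic_pi_eq (u v : padic_seq p_pr) :
  (\pi_(padic : Type) u = \pi_(padic : Type) v) <-> padic_null p (u - v).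
Proof.
split=> [/eqP|h].
  by rewrite -Quotient.idealrBE => /padic_nullbP.
by apply/eqP; rewrite -Quotient.idealrBE; apply/padic_nullbP.
Qed.

Lemma padic_pi0 : \pi_(padic : Type) (0 : padic_seq p_pr) = 0.
Proof. by rewrite pi_zeror. Qed.

Lemma padic_pi_eq0 (u : padic_seq p_pr) :
  (\pi_(padic : Type) u = 0) <-> padic_null p u.
Proof. by rewrite -padic_pi0 padic_pi_eq subr0. Qed.

Lemma padic_cauchy_cst (u : nat -> rat) : padic_cauchy p u -> ~ padic_null p u ->
  exists2 c, 0 < c & exists N, forall n, (N <= n)%N -> abs (u n) = c.
Proof.
move=> cu nu; have [e [e0 he]] : exists e, 0 < e /\
    forall N, exists2 n, (N <= n)%N & e <= abs (u n).
  apply: contra_notP nu => /forallNP h e e0.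
  have /not_andP[//|/existsNP[N hN]] := h e.
  exists N => n Nn; rewrite ltNge; apply/negP => en; apply: hN.
  by exists n.
have [N hN] := cu _ e0; have [n0 Nn0 en0] := he N.
exists (abs (u n0)); first exact: lt_le_trans en0.
exists N => n Nn; rewrite -[u n](subrK (u n0)) addrC padic_absD_eq//.
by apply: lt_le_trans en0; exact: hN.
Qed.

Lemma padic_seq_cauchy (u : padic_seq p_pr) : padic_cauchy p u.
Proof. exact/(padic_cauchybP p_pr)/padic_seqP. Qed.

Lemma padic_norm_eq (u : padic_seq p_pr) (c : rat) :
  (exists N, forall n, (N <= n)%N -> abs (u n) = c) ->
  padic_norm (\pi_(padic : Type) u) = c.
Proof.
move=> [N hN]; rewrite /padic_norm.
set v := repr _.
have /padic_pi_eq nuv : \pi_(padic : Type) v = \pi_(padic : Type) u by rewrite reprK.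
have [c0|cn0] := eqVneq c 0.
  have nv : padic_null p v.
    move=> e e0; have [M hM] := nuv _ e0; exists (maxn N M) => n.
    rewrite geq_max => /andP[Nn Mn]; have := hM _ Mn.
    have /eqP : abs (u n) = 0 by rewrite hN.
    rewrite padic_abs_eq0// => /eqP un0.
    have -> : (v - u) n = v n - u n by [].
    by rewrite un0 subr0.
  rewrite c0; case: xgetP => // d _ [M hM].
  have d_ge0 : 0 <= d by rewrite -(hM M)// padic_abs_ge0.
  apply/eqP/negPn/negP => dn0.
  have d0 : 0 < d by rewrite lt_def dn0.
  have [K hK] := nv _ d0.
  have := hK (maxn M K) (leq_maxr _ _); rewrite hM ?leq_maxl//.
  by rewrite ltxx.
have c0 : 0 < c.
  by rewrite lt_def cn0/= -(hN N)// padic_abs_ge0.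
have [M hM] := nuv _ c0.
have vc n : (maxn N M <= n)%N -> abs (v n) = c.
  rewrite geq_max => /andP[Nn Mn].
  have -> : v n = u n + (v n - u n) by ring.
  by rewrite padic_absD_eq ?hN//; exact: hM.
case: xgetP => [d _ [K hK]|/(_ c)h]; last by exfalso; apply: h; exists (maxn N M).
rewrite -(hK (maxn K (maxn N M))) ?leq_maxl//.
by rewrite vc ?leq_maxr.
Qed.

Lemma padicP x : exists u : padic_seq p_pr,
  x = \pi_(padic : Type) u /\
  exists N, forall n, (N <= n)%N -> abs (u n) = padic_norm x.
Proof.
have [->|x0] := eqVneq x 0.
  have cst0 : exists N, forall n, (N <= n)%N -> abs ((0 : padic_seq p_pr) n) = 0.
    by exists 0%N => n _; rewrite padic_abs0.
  exists 0; split; first by rewrite padic_pi0.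
  by rewrite -padic_pi0 (padic_norm_eq cst0).
exists (repr x); split; first by rewrite reprK.
have nn : ~ padic_null p (repr x).
  by move=> /padic_pi_eq0; rewrite reprK => /eqP; rewrite (negPf x0).
have [c c0 hc] := padic_cauchy_cst (padic_seq_cauchy (repr x)) nn.
by rewrite -{2}(reprK x) (padic_norm_eq hc).
Qed.

Lemma padic_norm_ge0 x : 0 <= padic_norm x.
Proof.
by have [u [_ [N h]]] := padicP x; rewrite -(h N)// padic_abs_ge0.
Qed.

Lemma padic_norm_eq0 x : (padic_norm x == 0) = (x == 0).
Proof.
have [u [xu [N h]]] := padicP x; apply/eqP/eqP => [n0|->].
  rewrite xu; apply/padic_pi_eq0 => e e0; exists N => n Nn.
  by rewrite h// n0.
rewrite -padic_pi0; apply: padic_norm_eq; exists 0%N => n _.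
by rewrite padic_abs0.
Qed.

Lemma padic_normM x y : padic_norm (x * y) = padic_norm x * padic_norm y.
Proof.
have [u [xu [N hN]]] := padicP x; have [v [yv [M hM]]] := padicP y.
have -> : x * y = \pi_(padic : Type) (u * v) by rewrite pi_mulr -xu -yv.
apply: padic_norm_eq; exists (maxn N M) => n; rewrite geq_max => /andP[Nn Mn].
have -> : (u * v) n = u n * v n by [].
by rewrite padic_absM// hN// hM.
Qed.

Lemma padic_normN x : padic_norm (- x) = padic_norm x.
Proof.
have [u [xu [N hN]]] := padicP x.
have -> : - x = \pi_(padic : Type) (- u) by rewrite pi_oppr -xu.
by apply: padic_norm_eq; exists N => n Nn; rewrite padic_absN hN.
Qed.

Lemma padic_normD x y :
  padic_norm (x + y) <= Num.max (padic_norm x) (padic_norm y).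
Proof.
have [u [xu [N hN]]] := padicP x; have [v [yv [M hM]]] := padicP y.
have xyE : x + y = \pi_(padic : Type) (u + v) by rewrite pi_addr -xu -yv.
have [w [zw [K hK]]] := padicP (x + y).
have [//|lt_xyz] := leP (padic_norm (x + y)) (Num.max (padic_norm x) (padic_norm y)).
have z0 : 0 < padic_norm (x + y).
  by rewrite (le_lt_trans _ lt_xyz)// le_max padic_norm_ge0.
have /padic_pi_eq h : \pi_(padic : Type) (u + v) = \pi_(padic : Type) w.
  by rewrite -xyE.
have [L hL] := h _ z0.
pose n := maxn (maxn N M) (maxn K L).
have [Nn Mn Kn Ln] : [/\ N <= n, M <= n, K <= n & L <= n]%N.
  by rewrite /n !leq_max !leqnn !orbT.
have := hL n Ln; rewrite -[X in _ < X](hK n Kn).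
have -> : (u + v - w) n = (u n + v n) - w n by [].
move=> lt1.
have lt2 : abs (u n + v n) < abs (w n).
  apply: (le_lt_trans (padic_absD p_pr _ _)).
  by rewrite hN// hM// hK.
have := padic_absD_eq p_pr (x := - w n) (y := u n + v n).
by rewrite padic_absN => /(_ lt2); rewrite addrC => eq1; rewrite eq1 ltxx in lt1.
Qed.

Lemma padic_mulVf x : x != 0 -> padic_inv x * x = 1.
Proof.
move=> x0; rewrite /padic_inv (negPf x0).
set u := repr x.
have xu : \pi_(padic : Type) u = x by rewrite /u reprK.
have nu : ~ padic_null p u.
  by move=> /padic_pi_eq0; rewrite xu => /eqP; rewrite (negPf x0).
have [c c0 [N hN]] := padic_cauchy_cst (padic_seq_cauchy u) nu.
have un0 n : (N <= n)%N -> u n != 0.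
  by move=> Nn; rewrite -(padic_abs_gt0 p_pr) hN.
have ci : (fun n => (u n)^-1) \in padic_cauchyb p_pr.
  apply/padic_cauchybP => e e0.
  have [M hM] := padic_seq_cauchy u (mulr_gt0 e0 (mulr_gt0 c0 c0)).
  exists (maxn N M) => m n; rewrite !geq_max => /andP[Nm Mm] /andP[Nn Mn].
  have -> : (u m)^-1 - (u n)^-1 = (u n - u m) / (u m * u n).
    by field; rewrite !un0.
  rewrite padic_absM// padic_absV// padic_absM// !hN//.
  by rewrite ltr_pdivrMr ?mulr_gt0// hM.
rewrite -[in X in _ * X]xu -pi_mulr -[RHS]pi_oner; apply/padic_pi_eq => e e0.
exists N => n Nn.
have -> : (padic_seq_inv u * u - 1) n = val (padic_seq_inv u) n * u n - 1 by [].
by rewrite /padic_seq_inv val_insubd ci mulVf ?un0// subrr padic_abs0.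
Qed.

Lemma padic_inv0 : padic_inv 0 = 0.
Proof. by rewrite /padic_inv eqxx. Qed.

HB.instance Definition _ :=
  GRing.ComNzRing_isField.Build padic padic_mulVf padic_inv0.

Lemma padic_norm_rat q : padic_norm (padic_rat q) = padic_abs p q.
Proof.
apply: padic_norm_eq; exists 0%N => n _; rewrite val_insubd ifT//.
by apply/padic_cauchybP => e e0; exists 0%N => k l _ _; rewrite subrr padic_abs0.
Qed.

Lemma padic_ler_normD x y : padic_norm (x + y) <= padic_norm x + padic_norm y.
Proof.
apply: (le_trans (padic_normD x y)).
by rewrite ge_max lerDl lerDr !padic_norm_ge0.
Qed.

End PadicNorm.

Section PadicTopology.
Variables (p : nat) (p_pr : prime p).
Local Notation padic := (padic p_pr).

Definition padic_dist (x y : padic) : rat := padic_norm (x - y).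

Lemma padic_distxx x : padic_dist x x = 0.
Proof. by apply/eqP; rewrite /padic_dist subrr padic_norm_eq0. Qed.

Lemma padic_dist_eq0 x y : padic_dist x y = 0 -> x = y.
Proof.
by move/eqP; rewrite padic_norm_eq0 subr_eq0 => /eqP.
Qed.

Lemma padic_distC x y : padic_dist x y = padic_dist y x.
Proof. by rewrite /padic_dist -padic_normN opprB. Qed.

Lemma padic_dist_triangle y x z :
  padic_dist x z <= padic_dist x y + padic_dist y z.
Proof.
have := padic_ler_normD (x - y) (y - z).
by rewrite addrA subrK.
Qed.

Lemma padic_dist_ultra x y z :
  padic_dist y z <= Num.max (padic_dist x y) (padic_dist x z).
Proof.
have := padic_normD (- (x - y)) (x - z); rewrite padic_normN.
by have -> : - (x - y) + (x - z) = y - z by ring.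
Qed.

HB.instance Definition _ := isMetric.Build rat padic
  padic_distxx padic_dist_eq0 padic_distC padic_dist_triangle.

HB.instance Definition _ := isPointed.Build padic 0.

(* Borel sigma-algebra *)
HB.instance Definition _ := Measurable.copy padic (g_sigma_algebraType (@open padic)).

(* closed ball of radius p^-k *)
Definition padic_ball (k : nat) (a : padic) : set padic :=
  [set x | padic_norm (x - a) <= p%:R ^- k].

Lemma open_padic_ball k a : open (padic_ball k a).
Proof.
rewrite openE => x /= xa; apply/nbhs_ballP; exists (p%:R ^- k) => /=.
  by rewrite invr_gt0 exprn_gt0// ltr0n prime_gt0.
move=> y; rewrite ballEmdist /= => /ltW xy.
by apply: (le_trans (padic_dist_ultra x y a)); rewrite ge_max; apply/andP; split.
Qed.

Lemma measurable_padic_ball k a : measurable (padic_ball k a).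
Proof. by apply: sub_sigma_algebra; exact: open_padic_ball. Qed.

End PadicTopology.

Local Open Scope complex_scope.

Import Normc.

Section ComplexAux.
Variable R : realType.
Implicit Types z w : R[i].

Lemma normcE2 z : normc z = Num.sqrt ((complex.Re z) ^+ 2 + (complex.Im z) ^+ 2).
Proof. by case: z. Qed.
Lemma normc_normr z : (normc z)%:C = `|z|. Proof. by []. Qed.
Lemma normc_ge0 z : 0 <= normc z. Proof. by rewrite normcE2 sqrtr_ge0. Qed.
Lemma normcD z w : normc (z + w) <= normc z + normc w.
Proof. by rewrite -lecR rmorphD/= !normc_normr ler_normD. Qed.
Lemma cReD z w : complex.Re (z + w) = complex.Re z + complex.Re w. Proof. by case: z; case: w. Qed.
Lemma cImD z w : complex.Im (z + w) = complex.Im z + complex.Im w. Proof. by case: z; case: w. Qed.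
Lemma cReM z w : complex.Re (z * w) = complex.Re z * complex.Re w - complex.Im z * complex.Im w.
Proof. by case: z; case: w. Qed.
Lemma cImM z w : complex.Im (z * w) = complex.Re z * complex.Im w + complex.Im z * complex.Re w.
Proof. by case: z; case: w. Qed.
End ComplexAux.

Section L2fun.
Context d (T : measurableType d) (R : realType).
Variable mu : {measure set T -> \bar R}.
Implicit Types f g : T -> R[i].

Definition cmeasurable_fun (D : set T) f :=
  measurable_fun D (fun x => complex.Re (f x)) /\ measurable_fun D (fun x => complex.Im (f x)).

Definition L2pred : {pred T -> R[i]} :=
  mem [set f | cmeasurable_fun setT f /\
               finite_norm mu 2%:E (fun x => normc (f x))].

Lemma L2predP f : f \in L2pred <->
  cmeasurable_fun setT f /\ finite_norm mu 2%:E (fun x => normc (f x)).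
Proof. by split=> [/set_mem//|h]; exact/mem_set. Qed.

Lemma measurable_normc D f : cmeasurable_fun D f ->
  measurable_fun D (fun x => normc (f x)).
Proof.
move=> [mr mi]; under eq_fun do rewrite normcE2.
apply: (@measurableT_comp _ _ _ _ _ _ (@Num.sqrt R)).
  by apply: continuous_measurable_fun; exact: sqrt_continuous.
apply: measurable_funD; exact: measurable_funX.
Qed.

Let one_le2 : (1 <= 2%:E :> \bar R)%E. Proof. by rewrite lee1n. Qed.

Lemma normc_Lfun f : f \in L2pred -> (fun x => normc (f x)) \in Lfun mu 2%:E.
Proof.
move=> /L2predP[mf ff]; apply/andP; split; apply/mem_set => //.
exact: measurable_normc.
Qed.

Lemma le_Lnorm2 (f g : T -> R) : measurable_fun setT f -> measurable_fun setT g ->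
  (forall x, `|f x| <= `|g x|) ->
  ('N[mu]_2%:E[EFin \o f] <= 'N[mu]_2%:E[EFin \o g])%E.
Proof.
move=> mf mg fg; rewrite unlock /Lnorm.
apply: gt0_ler_poweR; rewrite ?invr_ge0 ?ler0n//.
- by rewrite in_itv/= leey andbT integral_ge0// => x _; exact: poweR_ge0.
- by rewrite in_itv/= leey andbT integral_ge0// => x _; exact: poweR_ge0.
have mp (h : T -> R) : measurable_fun setT h ->
    measurable_fun setT (fun x : T => (`|(EFin \o h) x| `^ 2)%E).
  move=> mh; apply: (measurableT_comp (measurable_poweR 2)).
  by apply: measurableT_comp => //; exact/measurable_EFinP.
apply: ge0_le_integral => //.
- by move=> x _; apply: poweR_ge0.
- exact: mp.
- exact: mp.
move=> x _ /=; rewrite lee_fin ge0_ler_powR ?ler0n ?nnegrE//.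
Qed.

Lemma L2_submod_closed : submod_closed L2pred.
Proof.
split.
  apply/L2predP; split; first by split; exact: measurable_cst.
  rewrite /finite_norm (_ : _ \o _ = cst 0%E) ?Lnorm0//.
  by apply/funext => x; exact: (congr1 EFin (@normc0 R)).
move=> a f g fL gL; have fN := normc_Lfun fL; have gN := normc_Lfun gL.
move: fL gL => /L2predP[[fr fi] _] /L2predP[[gr gi] _].
have mh : cmeasurable_fun setT (a *: f + g).
  split.
    rewrite [X in measurable_fun _ X](_ : _ =
      (fun x => complex.Re a * complex.Re (f x) - complex.Im a * complex.Im (f x) + complex.Re (g x))); last first.
      by apply/funext => x; rewrite -cReM -cReD.
    apply: measurable_funD => //; apply: measurable_funB; exact: measurable_funM.
  rewrite [X in measurable_fun _ X](_ : _ =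
    (fun x => complex.Re a * complex.Im (f x) + complex.Im a * complex.Re (f x) + complex.Im (g x))); last first.
    by apply/funext => x; rewrite -cImM -cImD.
  by apply: measurable_funD => //; apply: measurable_funD; exact: measurable_funM.
apply/L2predP; split => //.
have hN : normc a *: (fun x => normc (f x)) + (fun x => normc (g x)) \in Lfun mu 2%:E.
  by have [_ /(_ (normc a))] := Lfun_submod_closed mu one_le2; apply.
have /andP[/set_mem mk /set_mem fk] := hN.
apply: le_lt_trans fk; apply: le_Lnorm2 => //; first exact: measurable_normc.
move=> x; rewrite !ger0_norm ?normc_ge0//; last first.
  by apply: addr_ge0; rewrite ?normc_ge0// mulr_ge0// normc_ge0.
apply: (le_trans (normcD _ _)).
rewrite lerD2r; have -> : (a *: f) x = a * f x by [].
by rewrite normcM; exact: lexx.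
Qed.

HB.instance Definition _ := GRing.isSubmodClosed.Build R[i] (T -> R[i]) L2pred
  L2_submod_closed.

Record L2fun := L2Fun { L2fun_val :> T -> R[i]; L2funP : L2fun_val \in L2pred }.

HB.instance Definition _ := [isSub for L2fun_val].
HB.instance Definition _ := gen_eqMixin L2fun.
HB.instance Definition _ := gen_choiceMixin L2fun.
HB.instance Definition _ := [SubChoice_isSubLmodule of L2fun by <:].

Definition L2null : {pred L2fun} :=
  fun f : L2fun => `[< {ae mu, forall x, f x = 0} >].

Lemma L2nullP (f : L2fun) : reflect {ae mu, forall x, f x = 0} (f \in L2null).
Proof. exact: asboolP. Qed.

Lemma L2null_submod_closed : submod_closed L2null.
Proof.
split; first by apply/L2nullP; apply/nearW.
move=> a f g /L2nullP f0 /L2nullP g0; apply/L2nullP.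
apply: filterS2 f0 g0 => x fx gx.
have -> : (a *: f + g) x = a * f x + g x by [].
by rewrite fx gx mulr0 addr0.
Qed.

HB.instance Definition _ := GRing.isSubmodClosed.Build R[i] L2fun L2null
  L2null_submod_closed.

End L2fun.

Section L2.
Local Open Scope quotient_scope.
Context d (T : measurableType d) (R : realType).
Variable mu : {measure set T -> \bar R}.

(* L^2(mu, C): square-integrable functions modulo equality almost everywhere *)
Definition L2 : Type := Quotient.quot (L2null (mu := mu)).
HB.instance Definition _ := GRing.Zmodule.on L2.

Definition L2class (f : L2fun mu) : L2 := \pi_(Quotient.quot (L2null (mu := mu))) f.
Definition L2repr (u : L2) : L2fun mu := repr (u : (Quotient.quot (L2null (mu := mu)))).
Lemma L2reprK u : L2class (L2repr u) = u. Proof. exact: reprK. Qed.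

Lemma L2classD f g : L2class (f + g) = L2class f + L2class g.
Proof. exact: pi_addr. Qed.
Lemma L2class0 : L2class 0 = 0.
Proof. exact: pi_zeror. Qed.

Lemma L2class_eq (f g : L2fun mu) :
  L2class f = L2class g <-> {ae mu, forall x, f x = g x}.
Proof.
have E : {ae mu, forall x, f x = g x} <-> (f - g \in L2null (mu := mu)).
  split=> [h|/L2nullP h].
    apply/L2nullP; apply: filterS h => x e.
    by have -> : (f - g) x = f x - g x by []; rewrite e subrr.
  apply: filterS h => x.
  by have -> : (f - g) x = f x - g x by []; move/eqP; rewrite subr_eq0 => /eqP.
rewrite E Quotient.idealrBE; split=> [h|/eqP//]; exact/eqP.
Qed.

Lemma L2reprP (f : L2fun mu) : {ae mu, forall x, L2repr (L2class f) x = f x}.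
Proof. by apply/L2class_eq; rewrite L2reprK. Qed.

Definition L2scale (a : R[i]) (u : L2) : L2 := L2class (a *: L2repr u).

Lemma L2scale_class a f : L2scale a (L2class f) = L2class (a *: f).
Proof.
apply/L2class_eq; apply: filterS (L2reprP f) => x e.
have -> : (a *: L2repr (L2class f)) x = a * L2repr (L2class f) x by [].
by rewrite e.
Qed.

Lemma L2scalerA a b u : L2scale a (L2scale b u) = L2scale (a * b) u.
Proof. by rewrite -(L2reprK u) !L2scale_class scalerA. Qed.
Lemma L2scale1r : left_id 1 L2scale.
Proof. by move=> u; rewrite -(L2reprK u) !L2scale_class scale1r. Qed.
Lemma L2scalerDr : right_distributive L2scale +%R.
Proof.
move=> a u v; rewrite -(L2reprK u) -(L2reprK v).
by rewrite -L2classD !L2scale_class scalerDr L2classD.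
Qed.
Lemma L2scalerDl u : {morph L2scale^~ u : a b / a + b}.
Proof.
by move=> a b; rewrite -(L2reprK u) !L2scale_class scalerDl L2classD.
Qed.
HB.instance Definition _ := GRing.Zmodule_isLmodule.Build R[i] L2
  L2scalerA L2scale1r L2scalerDr L2scalerDl.

Lemma L2classZ a f : L2class (a *: f) = a *: L2class f.
Proof. by rewrite -L2scale_class. Qed.

Definition L2norm (u : L2) : R :=
  fine ('N[mu]_2%:E[EFin \o (fun x => normc (L2repr u x))])%E.

Let nm (f : L2fun mu) : \bar R := ('N[mu]_2%:E[EFin \o (fun x => normc (f x))])%E.

Let nm_meas (f : L2fun mu) : measurable_fun setT (fun x => normc (f x)).
Proof. by apply: measurable_normc; have /L2predP[] := L2funP f. Qed.

Let nm_fin (f : L2fun mu) : nm f \is a fin_num.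
Proof.
rewrite fin_numElt (lt_le_trans ltNy0) ?Lnorm_ge0//=.
by have /L2predP[] := L2funP f.
Qed.

Let nmE (f : L2fun mu) : (L2norm (L2class f))%:E = nm f.
Proof.
rewrite /L2norm fineK; last exact: nm_fin.
have le_nm (g h : L2fun mu) : {ae mu, forall x, g x = h x} -> nm g = nm h.
  move=> gh; rewrite /nm unlock /Lnorm; congr (_ `^ _)%E.
  have mp (k : L2fun mu) :
    measurable_fun setT (fun x : T => (`|(normc (k x))%:E| `^ 2)%E).
    apply: (measurableT_comp (measurable_poweR 2)).
    by apply: measurableT_comp => //; exact/measurable_EFinP/nm_meas.
  apply: ae_eq_integral; [exact: measurableT|exact: mp|exact: mp|].
  by apply: filterS gh => x e _ /=; rewrite e.
exact/le_nm/L2reprP.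
Qed.

Lemma L2normD u v : L2norm (u + v) <= L2norm u + L2norm v.
Proof.
rewrite -(L2reprK u) -(L2reprK v) -L2classD.
set f := L2repr u; set g := L2repr v.
rewrite -lee_fin EFinD !nmE.
apply: (@le_trans _ _ ('N[mu]_2%:E[(EFin \o (fun x => normc (f x)))
    \+ (EFin \o (fun x => normc (g x)))]%E)).
  apply: (@le_Lnorm2 _ _ _ _ (fun x => normc ((f + g) x))
     (fun x => normc (f x) + normc (g x))).
  - exact: nm_meas.
  - by apply: measurable_funD; exact: nm_meas.
  move=> x; rewrite !ger0_norm ?addr_ge0 ?normc_ge0//.
  exact: normcD.
by apply: eminkowski; [exact: nm_meas|exact: nm_meas|rewrite lee1n].
Qed.

Lemma L2normZ a u : L2norm (a *: u) = normc a * L2norm u.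
Proof.
rewrite -(L2reprK u) -L2classZ; set f := L2repr u.
apply/EFin_inj; rewrite EFinM !nmE.
have fL := normc_Lfun (L2funP f).
have one_le2 : (1 <= 2%:E :> \bar R)%E by rewrite lee1n.
have := LnormZ (Lfun_Sub one_le2 fL) (normc a).
rewrite ger0_norm ?normc_ge0// => <-.
apply: eq_Lnorm => x /=; congr EFin; exact: normcM.
Qed.

Lemma L2norm_eq0 u : L2norm u = 0 -> u = 0.
Proof.
rewrite -(L2reprK u); set f := L2repr u => h.
have nf0 : nm f = 0%E by rewrite -nmE h.
rewrite -L2class0; apply/L2class_eq.
have /measurable_EFinP mf := nm_meas f.
have := Lnorm_eq0_eq0 mf _ nf0; rewrite lte0n => /(_ isT).
apply: filterS => x /(_ I) /= [] /eq0_normc.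
by move=> ->.
Qed.

Let cnormD u v : (L2norm (u + v))%:C <= (L2norm u)%:C + (L2norm v)%:C.
Proof. by rewrite -rmorphD/= lecR L2normD. Qed.
Let cnormZ a u : (L2norm (a *: u))%:C = `|a| * (L2norm u)%:C.
Proof. by rewrite L2normZ rmorphM. Qed.
Let cnorm0 u : (L2norm u)%:C = 0 -> u = 0.
Proof. by move=> /complexI /L2norm_eq0. Qed.

HB.instance Definition _ := Lmodule_isNormed.Build R[i] L2 cnormD cnormZ cnorm0.

Lemma L2norm_normr (u : L2) : `|u| = (L2norm u)%:C.
Proof. by []. Qed.

End L2.


Section L2bounded.
Context d (T : measurableType d) (R : realType).
Variable mu : {measure set T -> \bar R}.
Implicit Types f h : T -> R[i].

Lemma cmeasurable_funM D f h : cmeasurable_fun D f -> cmeasurable_fun D h ->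
  cmeasurable_fun D (fun x => h x * f x).
Proof.
move=> [fr fi] [hr hi]; split.
  under eq_fun do rewrite cReM.
  by apply: measurable_funB; exact: measurable_funM.
under eq_fun do rewrite cImM.
by apply: measurable_funD; exact: measurable_funM.
Qed.

Lemma L2pred_bounded_mul f h (M : R) : cmeasurable_fun setT h ->
  (forall x, normc (h x) <= M) -> f \in L2pred mu ->
  (fun x => h x * f x) \in L2pred mu.
Proof.
move=> mh hM fL; have /L2predP[mf _] := fL.
have mhf := cmeasurable_funM mf mh.
have MfL : (M%:C *: f) \in L2pred mu by rewrite rpredZ.
have /L2predP[mMf finMf] := MfL.
apply/L2predP; split => //; apply: le_lt_trans finMf.
apply: le_Lnorm2; [exact: measurable_normc|exact: measurable_normc|].
move=> x; rewrite !ger0_norm ?normc_ge0//.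
have -> : (M%:C *: f) x = M%:C * f x by [].
rewrite !normcM ler_wpM2r ?normc_ge0//.
apply: (le_trans (hM x)).
by rewrite normcE2/= expr0n/= addr0 sqrtr_sqr ler_norm.
Qed.

Lemma L2pred_bounded h (M : R) : (mu setT < +oo)%E -> cmeasurable_fun setT h ->
  (forall x, normc (h x) <= M) -> h \in L2pred mu.
Proof.
move=> muoo mh hM.
have one : (fun=> 1 : R[i]) \in L2pred mu.
  apply/L2predP; split; first by split; exact: measurable_cst.
  rewrite /finite_norm.
  have -> : EFin \o (fun=> normc (1 : R[i])) = cst (1%E : \bar R) :> (T -> \bar R).
    by apply/funext => x /=; rewrite [X in X%:E](normc1 R).
  by rewrite Lnorm_cst1 poweR_lty.
have := L2pred_bounded_mul mh hM one.
by under eq_fun do rewrite mulr1.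
Qed.

End L2bounded.

Section Haar.
Variables (p : nat) (p_pr : prime p) (R : realType).

(* the Haar measure with total mass 1 on Z_p = {x | |x|_p <= 1}, on the Borel
   sets of Q_p *)
Record haar_measure := HaarMeasure {
  haar :> {measure set (padic p_pr) -> \bar R};
  haar_translate : forall (a : padic p_pr) (A : set (padic p_pr)),
    measurable A -> haar [set a + x | x in A] = haar A;
  haar_Zp : haar [set x | padic_norm x <= 1] = 1%E }.

Lemma haar_ball_fin (mu : haar_measure) N a : (mu (padic_ball N a) < +oo)%E.
Proof.
have -> : padic_ball N a = [set a + x | x in padic_ball N 0].
  apply/seteqP; split => x /=.
    by move=> xa; exists (x - a); [rewrite /padic_ball/= subr0|rewrite addrC subrK].
  by move=> [y]; rewrite /padic_ball/= subr0 => yN <-; rewrite addrAC subrr add0r.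
rewrite haar_translate; last exact: measurable_padic_ball.
apply: (@le_lt_trans _ _ 1%E); last exact: ltry.
rewrite -(haar_Zp mu); apply: le_measure; rewrite ?inE.
- exact: measurable_padic_ball.
- have -> : [set x : padic p_pr | padic_norm x <= 1] = padic_ball 0 0.
    by apply/seteqP; split => x /=; rewrite /padic_ball/= subr0 expr0 invr1.
  exact: measurable_padic_ball.
move=> x; rewrite /padic_ball/= subr0 => /le_trans; apply.
by rewrite invf_le1 ?exprn_gt0 ?ltr0n ?prime_gt0// exprn_ege1// ler1n prime_gt0.
Qed.

End Haar.

Section Laplacian.
Variables (p : nat) (p_pr : prime p) (R : realType) (mu : haar_measure p_pr R).
Variables (N n : nat) (V : 'I_n -> padic p_pr).
Local Notation padic := (padic p_pr).

(* V is presented by an enumeration of its n points. *)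
Definition is_vertex_set :=
  [/\ injective V,
      forall i, exists d : 'I_N -> 'I_p,
        V i = \sum_(k < N) (d k)%:R * p%:R ^+ k &
      trivIset setT (fun i => padic_ball N (V i))].

Definition KN : set padic := \bigcup_i padic_ball N (V i).

Lemma measurable_KN : measurable KN.
Proof.
apply: fin_bigcup_measurable => // i _; exact: measurable_padic_ball.
Qed.

Lemma haar_KN_fin : (mu KN < +oo)%E.
Proof.
have -> : KN = \big[setU/set0]_(i in 'I_n) padic_ball N (V i).
  rewrite -bigcup_pred; congr bigcup.
  by apply/seteqP; split.
apply: (proj2 (A := measurable (\big[setU/set0]_(i in 'I_n) padic_ball N (V i)))).
apply: (big_ind (fun A => measurable A /\ (mu A < +oo)%E)).
- by split; [exact: measurable0|rewrite measure0].
- move=> A B [mA Aoo] [mB Boo]; split; first exact: measurableU.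
  apply: (@le_lt_trans _ _ (mu A + mu B)%E); first exact: measureU2.
  exact: lte_add_pinfty.
- by move=> i _; split; [exact: measurable_padic_ball|exact: haar_ball_fin].
Qed.

Definition Omega (i : 'I_n) (x : padic) : R[i] := (x \in padic_ball N (V i))%:R.

Definition degree (A : 'M[R]_n) (i : 'I_n) : R := \sum_j A i j.

(* A i i cancels in graph_Laplacian A but not in degree A i, so the operator
   padic_Laplacian A below is not a function of graph_Laplacian A alone. *)
Definition graph_Laplacian (A : 'M[R]_n) : 'M[R]_n :=
  A - diag_mx (\row_i degree A i).

Definition cintegral (D : set padic) (f : padic -> R[i]) : R[i] :=
  (\int[mu]_(x in D) complex.Re (f x))%R +i* (\int[mu]_(x in D) complex.Im (f x))%R.

Definition Laplacian_fun (A : 'M[R]_n) (u : padic -> R[i]) : padic -> R[i] :=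
  fun x =>
    cintegral KN (fun y =>
      p%:R ^+ N * (\sum_i \sum_j (A i j)%:C * Omega i x * Omega j y) * u y)
    - (\sum_i (degree A i)%:C * Omega i x) * u x.

(* L^2(K_N, C) is L^2 of Q_p for the Haar measure restricted to K_N. *)
Definition muK : {measure set padic -> \bar R} := mrestr mu measurable_KN.
Definition L2K : normedModType R[i] := L2 muK.

Definition ball_type (x : padic) : {ffun 'I_n -> bool} :=
  [ffun i => x \in padic_ball N (V i)].

Lemma measurable_ball_type (phi : {ffun 'I_n -> bool} -> R) :
  measurable_fun setT (phi \o ball_type).
Proof.
move=> _ Y mY; rewrite setTI.
have -> : (phi \o ball_type) @^-1` Y =
  \bigcup_(c in [set c | Y (phi c)])
    \bigcap_(i in [set: 'I_n])
      (if c i then padic_ball N (V i) else ~` padic_ball N (V i)).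
  apply/seteqP; split => x /=.
    move=> Yx; exists (ball_type x) => //= i _.
    by rewrite ffunE; case: ifPn => [/set_mem//|/negP h /mem_set].
  move=> [c Yc h]; have -> : ball_type x = c; last by [].
  apply/ffunP => i; rewrite ffunE; have := h i I.
  by case: (c i) => [/mem_set//|hx]; apply/negP => /set_mem.
apply: fin_bigcup_measurable => //.
move=> c _; apply: fin_bigcap_measurable => // i _.
by case: ifP => _; [|apply: measurableC]; exact: measurable_padic_ball.
Qed.

Lemma ball_type_bounded (F : {ffun 'I_n -> bool} -> R[i]) :
  exists M, forall x, normc (F (ball_type x)) <= M.
Proof.
exists (\sum_c normc (F c)) => x.
rewrite (bigD1 (ball_type x))//= lerDl sumr_ge0// => c _; exact: normc_ge0.
Qed.

Lemma Laplacian_fun_L2 (A : 'M[R]_n) (u : padic -> R[i]) :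
  u \in L2pred muK -> Laplacian_fun A u \in L2pred muK.
Proof.
move=> uL.
have factL (F : {ffun 'I_n -> bool} -> R[i]) : cmeasurable_fun setT (F \o ball_type).
  split; first exact: (measurable_ball_type (fun c => complex.Re (F c))).
  exact: (measurable_ball_type (fun c => complex.Im (F c))).
pose G (c : {ffun 'I_n -> bool}) : R[i] := cintegral KN (fun y =>
  p%:R ^+ N * (\sum_i \sum_j (A i j)%:C * (c i : bool)%:R * Omega j y) * u y).
pose g (c : {ffun 'I_n -> bool}) := \sum_i (degree A i)%:C * (c i : bool)%:R : R[i].
have -> : Laplacian_fun A u =
    (fun x => (G \o ball_type) x) - (fun x => (g \o ball_type) x * u x).
  apply/funext => x; rewrite /Laplacian_fun.
  transitivity (G (ball_type x) - g (ball_type x) * u x); last by [].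
  congr (_ - _ * _).
    congr cintegral; apply/funext => y; congr (_ * _ * _).
    by apply: eq_bigr => i _; apply: eq_bigr => j _; rewrite ffunE.
  by apply: eq_bigr => i _; rewrite ffunE.
have [M hM] := ball_type_bounded G; have [M' hM'] := ball_type_bounded g.
apply: rpredB.
  apply: (L2pred_bounded (M := M)) => //.
  by rewrite /muK/= /mrestr setTI haar_KN_fin.
apply: (L2pred_bounded_mul (M := M')) => //.
Qed.

Definition padic_Laplacian (A : 'M[R]_n) (u : L2K) : L2K :=
  L2class (L2Fun (Laplacian_fun_L2 A (L2funP (L2repr u)))).

End Laplacian.

Section Evolution.
Variables (R : realType) (H : normedModType R[i]).

Definition bounded_operator (B : H -> H) : Prop :=
  linear B /\ exists M : R[i], forall u, `|B u| <= M * `|u|.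

(* exp(B) u = \sum_k B^k u / k! *)
Definition exp_op (B : H -> H) (u : H) : H :=
  limn (series (fun k => (k`!%:R^-1 : R[i]) *: iter k B u)).

(* u is C^1 on [s, +oo[, with a one-sided derivative at s. *)
Definition strict_solution (B : R -> H -> H) (s : R) (u0 : H) (u : R -> H) : Prop :=
  [/\ u s = u0,
      forall t, s <= t ->
        (h^-1)%:C *: (u (t + h) - u t) @[h --> within [set h | s <= t + h] 0^']
          --> B t (u t) &
      {within [set t | s <= t], continuous (fun t => B t (u t))}].

Definition evolution_family (B : R -> H -> H) (U : R -> R -> H -> H) : Prop :=
  forall s, 0 <= s ->
    (forall t, s <= t -> bounded_operator (U t s)) /\
    (forall u0, strict_solution B s u0 (fun t => U t s u0) /\
       forall u, strict_solution B s u0 u -> forall t, s <= t -> u t = U t s u0).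

(* the factor with time s + h is applied first, the one with time t last *)
Definition time_discretisation (B : R -> H -> H) (m : nat) (t s : R) (u0 : H) : H :=
  let h := (t - s) / m%:R in
  foldl (fun u k => exp_op (fun v => h%:C *: B (s + k%:R * h) v) u) u0 (iota 1 m).

End Evolution.

(* At a boundary point of D the power series represents f on D only. *)
Definition analytic_on (R : realType) (D : set R) (f : R -> R) : Prop :=
  forall t0, D t0 -> exists (a : nat -> R) (r : R), 0 < r /\
    forall t, D t -> `|t - t0| < r ->
      series (fun k => a k * (t - t0) ^+ k) @ \oo --> f t.

(* Main.v *)
(** The operators [padic_Laplacian (A t)] are bounded and, since the entries of
    [A] are analytic, Lipschitz in [t] on [[s, t]]. Freezing the operator at the
    right end of a step of length [h] therefore costs [O(h^2)] (mean value
    inequality for the solution, Taylor bound for the exponential), and each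
    exponential has norm at most [e^(h M)], so that the [m] local errors add up to
    [O(m h^2) = O(1/m)].

    The completeness of [L^2] is not needed for the exponential series: the orbit
    of [u] stays in the span of [u], its restrictions to the balls and the
    indicators of the balls, on which the Laplacian acts as a matrix. *)

Require Import Defs.
From HB Require Import structures.
From mathcomp Require Import all_boot all_order all_algebra complex.
From mathcomp Require Import ring lra.
From mathcomp Require Import all_classical all_reals all_analysis.
From mathcomp Require Import measurable_realfun.
Import Order.TTheory GRing.Theory Num.Theory.
Import numFieldNormedType.Exports.
Local Open Scope classical_set_scope.
Local Open Scope ring_scope.
Local Open Scope complex_scope.

Set Implicit Arguments.
Unset Strict Implicit.
Unset Printing Implicit Defensive.

(** * Calculus in complex normed modules *)

(** The supremum [c] of the points reachable from [a] is itself reachable, and the local hypothesis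
    at [c] carries [P] beyond [c] unless [c = b]. This replaces compactness of the interval wherever
    a local estimate is made global. *)
Lemma interval_cousin (R : realType) (P : R -> R -> Prop) (a b : R) : a <= b ->
  (forall x y z, a <= x <= y -> y <= z <= b -> P x y -> P y z -> P x z) ->
  (forall x, a <= x <= b -> exists2 d, 0 < d &
     forall y z, a <= y <= x -> x <= z <= b -> z - y < d -> P y z) ->
  P a b.
Proof.
move=> ab Ptrans Ploc.
pose S := [set c | a <= c <= b /\ P a c].
have Sa : S a.
  split; first by rewrite lexx.
  have [|d d0 hd] := Ploc a; first by rewrite lexx.
  by apply: hd; rewrite ?lexx ?subrr.
have supS : has_sup S.
  by split; [exists a|exists b => x [/andP[]]].
pose c := sup S.
have ac : a <= c by apply: sup_upper_bound Sa.
have cb : c <= b by apply: ge_sup; [exists a|move=> x [/andP[]]].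
have [|d d0 hd] := Ploc c; first by rewrite ac.
have d40 : 0 < d / 4 by rewrite divr_gt0.
have [x [/andP[ax xb] Px] cx] := sup_adherent d40 supS.
have xc : x <= c by apply: sup_upper_bound; [|split; [rewrite ax|]].
(* The interval from [x] to [z] contains [c] and is shorter than [d / 2], so [P x z] holds. Then [z]
   lies in [S], which is possible only if the minimum is [b]. *)
pose z := Num.min b (c + d / 4).
have zb : z <= b by rewrite /z ge_min lexx.
have zc : z <= c + d / 4 by rewrite /z ge_min lexx orbT.
have cz : c <= z by rewrite /z le_min cb lerDl ltW.
have Pz : P a z.
  apply: (Ptrans a x z); rewrite ?lexx ?ax ?zb ?(le_trans xc)//.
  apply: hd; rewrite ?ax ?cz//.
  by move: cx; rewrite -/c; lra.
have zS : z <= c.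
  by apply: sup_upper_bound => //; split => //; rewrite zb (le_trans ac).
suff -> : b = z by [].
by rewrite /z; case: leP => // h; move: zS; rewrite /z min_r ?(ltW h)//; lra.
Qed.

Section RealNorm.
Variables (R : realType) (H : normedModType R[i]).
Implicit Types u v : H.

(* The norm of [H] takes its values in [R[i]]; [nrm] is its real version. *)
Definition nrm u : R := complex.Re `|u|.

Lemma nrmE u : `|u| = (nrm u)%:C.
Proof.
have := normr_ge0 u; rewrite /nrm; case: `|u| => x y /=.
by rewrite lecE /= => /andP[/eqP -> _].
Qed.

Lemma nrm_ge0 u : 0 <= nrm u.
Proof. by rewrite -lecR -nrmE normr_ge0. Qed.

Lemma nrmD u v : nrm (u + v) <= nrm u + nrm v.
Proof. by rewrite -lecR rmorphD/= -!nrmE ler_normD. Qed.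

Lemma nrmZc (a : R[i]) u : nrm (a *: u) = Normc.normc a * nrm u.
Proof.
apply/complexI; rewrite rmorphM/= -!nrmE normrZ; congr (_ * _).
Qed.

Lemma nrmZ (a : R) u : nrm (a%:C *: u) = `|a| * nrm u.
Proof. by rewrite nrmZc /Normc.normc /= expr0n addr0 sqrtr_sqr. Qed.

Lemma nrm0 : nrm (0 : H) = 0.
Proof. by rewrite /nrm normr0. Qed.

Lemma nrmN u : nrm (- u) = nrm u.
Proof. by rewrite /nrm normrN. Qed.

Lemma nrm_sum (I : Type) (r : seq I) (F : I -> H) :
  nrm (\sum_(i <- r) F i) <= \sum_(i <- r) nrm (F i).
Proof.
elim/big_rec2: _ => [|i x y _ h]; first by rewrite nrm0.
by apply: (le_trans (nrmD _ _)); rewrite lerD2l.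
Qed.

Lemma nrm_sub_triangle u v w : nrm (u - w) <= nrm (u - v) + nrm (v - w).
Proof. by apply: le_trans (nrmD _ _); rewrite addrA subrK. Qed.

Lemma ltc_nrm u (e : R) : (`|u| < e%:C) = (nrm u < e).
Proof. by rewrite nrmE ltcR. Qed.

(** Closed balls are closed. The centre is kept general: [0] gives the norm bound for the
    exponential, [v + B v] its Taylor bound. *)
Lemma nrm_cvg_le (f : nat -> H) l (c : H) (K : R) :
  f @ \oo --> l -> (\forall n \near \oo, nrm (f n - c) <= K) -> nrm (l - c) <= K.
Proof.
move=> fl fK; apply/ler_addgt0Pr => e e0.
have e0' : 0 < e%:C by rewrite ltcR.
have /cvgrPdist_lt/(_ _ e0') hl := fl.
have [n [h1 h2]] : exists n, `|l - f n| < e%:C /\ nrm (f n - c) <= K.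
  have : \forall n \near \oo, `|l - f n| < e%:C /\ nrm (f n - c) <= K.
    by near=> n; split; near: n.
  by move=> /filter_ex.
move: h1; rewrite ltc_nrm => h1.
by rewrite [K + e]addrC; apply: (le_trans (nrm_sub_triangle _ (f n) _)); rewrite lerD// ltW.
Unshelve. all: by end_near. Qed.

(** Differentiability within the closed interval, one-sided at the end points. The form without
    quotients makes sense at [y = x] too and feeds directly into norm estimates. *)
Definition has_deriv (a b : R) (f g : R -> H) : Prop :=
  forall x, a <= x <= b -> forall e, 0 < e -> exists2 d, 0 < d &
    forall y, a <= y <= b -> `|y - x| < d ->
      nrm (f y - f x - (y - x)%:C *: g x) <= e * `|y - x|.

Lemma has_deriv_sub a b a' b' f g : a <= a' -> b' <= b ->
  has_deriv a b f g -> has_deriv a' b' f g.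
Proof.
move=> aa bb h x /andP[ax xb] e e0.
have [|d d0 hd] := h x _ e e0; first by rewrite (le_trans aa)// (le_trans xb).
exists d => // y /andP[ay yb]; apply: hd.
by rewrite (le_trans aa)// (le_trans yb).
Qed.

(** With this the mean value inequality compares [f] with the affine motion of constant velocity
    [c]. *)
Lemma has_deriv_subZ a b f g (c : H) : has_deriv a b f g ->
  has_deriv a b (fun x => f x - x%:C *: c) (fun x => g x - c).
Proof.
move=> h x xab e e0; have [d d0 hd] := h x xab e e0.
exists d => // y yab yx; move: (hd y yab yx).
rewrite opprD addrACA -opprD scalerBr -scalerBl -rmorphB/=.
by rewrite [- (_ *: g x - _)]opprB addrA subrK.
Qed.

(** With a slack [e] added to [K], the inequality holds on short intervals around each point and is
    additive under concatenation, so [interval_cousin] gives it on the whole interval; then [e]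
    tends to [0]. *)
Lemma mean_value_ineq a b f g K : a <= b -> has_deriv a b f g ->
  (forall x, a <= x <= b -> nrm (g x) <= K) -> nrm (f b - f a) <= K * (b - a).
Proof.
move=> ab fg gK.
suff h e : 0 < e -> nrm (f b - f a) <= (K + e) * (b - a).
  move: ab; rewrite le_eqVlt => /orP[/eqP->|ab].
    by rewrite !subrr nrm0 mulr0.
  apply/ler_addgt0Pr => e e0.
  have ba : 0 < b - a by rewrite subr_gt0.
  apply: (le_trans (h (e / (b - a)) _)); first by rewrite divr_gt0.
  by rewrite mulrDl divfK ?gt_eqF.
move=> e0.
apply: (@interval_cousin _ (fun x y => nrm (f y - f x) <= (K + e) * (y - x))) => //.
  move=> x y z _ _ h1 h2.
  have -> : (K + e) * (z - x) = (K + e) * (z - y) + (K + e) * (y - x) by ring.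
  by apply: (le_trans (nrm_sub_triangle _ (f y) _)); rewrite lerD.
move=> x xab; have [d d0 hd] := fg x xab e e0.
have loc y : a <= y <= b -> `|y - x| < d -> nrm (f y - f x) <= (K + e) * `|y - x|.
  move=> yab yx; have := hd y yab yx => h.
  rewrite -[f y - f x](subrK ((y - x)%:C *: g x)).
  apply: (le_trans (nrmD _ _)); rewrite nrmZ addrC mulrDl lerD//.
  by rewrite mulrC ler_wpM2r// gK.
(* The derivative at [x] only controls differences from [f x], so the interval is split at [x]. *)
exists d => // y z /andP[ay yx] /andP[xz zb] zyd.
have /andP[ax xb] := xab.
have yx' : `|y - x| = x - y by rewrite distrC ger0_norm// subr_ge0.
have zx' : `|z - x| = z - x by rewrite ger0_norm// subr_ge0.
have -> : (K + e) * (z - y) = (K + e) * `|z - x| + (K + e) * `|y - x|.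
  by rewrite yx' zx'; ring.
apply: (le_trans (nrm_sub_triangle _ (f x) _)); apply: lerD.
  by apply: loc; rewrite ?zx' ?(le_trans ax)//; lra.
rewrite -nrmN opprB.
by apply: loc; rewrite ?yx' ?ay ?(le_trans yx)//; lra.
Qed.

(** Differentiability at a point bounds [f] near it. When two intervals are joined, the sum of the
    two bounds serves for both. *)
Lemma has_deriv_bounded a b f g : a <= b -> has_deriv a b f g ->
  exists2 C, 0 <= C & forall x, a <= x <= b -> nrm (f x) <= C.
Proof.
move=> ab fg.
apply: (@interval_cousin _ (fun x y => exists2 C, 0 <= C &
    forall z, x <= z <= y -> nrm (f z) <= C) a b) => //.
  move=> x y z _ _ [C C0 hC] [D D0 hD]; exists (C + D); first by rewrite addr_ge0.
  move=> w /andP[xw wz]; have [wy|yw] := leP w y.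
    by apply: (le_trans (hC w _)); rewrite ?xw// lerDl.
  by apply: (le_trans (hD w _)); rewrite ?wz ?(ltW yw)// lerDr.
move=> x xab; have [d d0 hd] := fg x xab 1 ltr01.
(* Within distance [d] of [x], the remainder (taken with [e = 1]) contributes at most [d] and the
   linear part at most [nrm (g x) * d]. *)
have C0 : 0 <= nrm (f x) + (1 + nrm (g x)) * d.
  by rewrite addr_ge0 ?mulr_ge0 ?addr_ge0 ?nrm_ge0 ?ltW.
exists d => // y z /andP[ay yx] /andP[xz zb] zyd.
exists (nrm (f x) + (1 + nrm (g x)) * d) => // w /andP[yw wz].
have wx : `|w - x| < d by rewrite ltr_norml; apply/andP; split; lra.
have := hd w _ wx; rewrite (le_trans ay yw) (le_trans wz zb) => /(_ isT) h.
have -> : f w = f x + ((f w - f x - (w - x)%:C *: g x) + (w - x)%:C *: g x).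
  by rewrite subrK addrC subrK.
apply: (le_trans (nrmD _ _)); rewrite lerD2l.
apply: (le_trans (nrmD _ _)); rewrite nrmZ mulrDl lerD//.
  by apply: (le_trans h); rewrite ler_wpM2l// ltW.
by rewrite mulrC ler_wpM2l ?nrm_ge0// ltW.
Qed.

End RealNorm.

(** * Operator exponentials and the discretisation error *)

Lemma exp_partial_le (R : realType) (x : R) n : 0 <= x ->
  \sum_(0 <= k < n) x ^+ k / k`!%:R <= expR x.
Proof.
move=> x0; apply: (nondecreasing_cvgn_le _ (is_cvg_series_exp_coeff x) n).
by apply: nondecreasing_series => k _ _; exact: exp_coeff_ge0.
Qed.

Section Exponential.
Variables (R : realType) (H : normedModType R[i]) (B : H -> H) (x : R).
Hypotheses (linB : linear B) (x0 : 0 <= x)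
  (leB : forall v, nrm (B v) <= x * nrm v)
  (cvB : forall v, cvgn (series (fun k => (k`!%:R^-1 : R[i]) *: iter k B v))).

Let expB_cvg v :
  series (fun k => (k`!%:R^-1 : R[i]) *: iter k B v) @ \oo --> exp_op B v.
Proof. exact: cvB. Qed.

Lemma nrm_iter k v : nrm (iter k B v) <= x ^+ k * nrm v.
Proof.
elim: k => [|k IH] /=; first by rewrite mul1r.
by rewrite exprS -mulrA (le_trans (leB _))// ler_wpM2l.
Qed.

Lemma iter_sub k v w : iter k B (v - w) = iter k B v - iter k B w.
Proof.
have lB a b : B (a - b) = B a - B b.
  by rewrite -[in LHS]scaleN1r addrC linB scaleN1r addrC.
by elim: k => //= k ->.
Qed.

Lemma nrm_exp_term k v :
  nrm ((k`!%:R^-1 : R[i]) *: iter k B v) <= x ^+ k / k`!%:R * nrm v.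
Proof.
have -> : (k`!%:R^-1 : R[i]) = (k`!%:R^-1 : R)%:C by rewrite fmorphV/= rmorph_nat.
rewrite nrmZ ger0_norm// [_ / _]mulrC -mulrA ler_wpM2l ?invr_ge0//.
exact: nrm_iter.
Qed.

(** Used to push the error accumulated so far through one more exponential factor. *)
Lemma exp_op_sub v w : exp_op B (v - w) = exp_op B v - exp_op B w.
Proof.
apply: cvg_lim; first exact: norm_hausdorff.
rewrite (_ : series _ = series (fun k => (k`!%:R^-1 : R[i]) *: iter k B v) -
   series (fun k => (k`!%:R^-1 : R[i]) *: iter k B w)); last first.
  apply/funext => n; rewrite /series/= fctE/= -sumrB.
  by apply: eq_bigr => k _; rewrite iter_sub scalerBr.
by apply: cvgB; exact: expB_cvg.
Qed.

Lemma nrm_exp_le v : nrm (exp_op B v) <= expR x * nrm v.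
Proof.
rewrite -[exp_op B v]subr0; apply: (nrm_cvg_le (@expB_cvg v)).
near=> n; rewrite subr0 /series/=.
apply: (le_trans (nrm_sum _ _)).
apply: (@le_trans _ _ (\sum_(0 <= k < n) x ^+ k / k`!%:R * nrm v)).
  by apply: ler_sum => k _; exact: nrm_exp_term.
by rewrite -mulr_suml ler_wpM2r ?nrm_ge0// exp_partial_le.
Unshelve. all: by end_near. Qed.

(** Since (k+2)! is at least k!, the tail from index 2 is dominated by [x ^+ 2] times the series of
    [expR x]. *)
Lemma nrm_exp_taylor v : nrm (exp_op B v - (v + B v)) <= x ^+ 2 * expR x * nrm v.
Proof.
apply: (nrm_cvg_le (@expB_cvg v)).
near=> n; have n2 : (2 <= n)%N by near: n; exists 2%N.
rewrite /series/= (big_ltn (ltnW n2)) (big_ltn n2) /= addrA.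
rewrite !invr1 !scale1r [X in nrm X](_ : _ =
  \sum_(2 <= k < n) (k`!%:R^-1 : R[i]) *: iter k B v); last first.
  by rewrite [LHS]addrC; exact: addKr.
apply: (le_trans (nrm_sum _ _)).
apply: (@le_trans _ _ (\sum_(2 <= k < n) x ^+ k / k`!%:R * nrm v)).
  by apply: ler_sum => k _; exact: nrm_exp_term.
rewrite -mulr_suml ler_wpM2r ?nrm_ge0//.
apply: (@le_trans _ _ (x ^+ 2 * \sum_(0 <= k < (n - 2)) x ^+ k / k`!%:R)); last first.
  by rewrite ler_wpM2l ?exprn_ge0// exp_partial_le.
rewrite mulr_sumr -{1}[2%N]add0n big_addn; apply: ler_sum => k _.
rewrite exprD [leRHS]mulrA [x ^+ k * _]mulrC ler_wpM2l ?mulr_ge0 ?exprn_ge0//.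
rewrite lef_pV2 ?posrE ?ltr0n ?fact_gt0// ler_nat.
exact/leq_fact/leq_addr.
Unshelve. all: by end_near. Qed.

End Exponential.

Section Discretisation.
Variables (R : realType) (H : normedModType R[i]) (B : R -> H -> H).
Variables (s T M Lip : R) (u : R -> H).
Hypotheses (sT : s <= T) (M0 : 0 <= M) (Lip0 : 0 <= Lip)
  (linB : forall t, linear (B t))
  (leB : forall t v, s <= t <= T -> nrm (B t v) <= M * nrm v)
  (lipB : forall t r v, s <= t <= T -> s <= r <= T ->
     nrm (B t v - B r v) <= Lip * `|t - r| * nrm v)
  (cvB : forall t (c : R) v, s <= t <= T -> cvgn
     (series (fun k => (k`!%:R^-1 : R[i]) *: iter k (fun w => c%:C *: B t w) v)))
  (derU : has_deriv s T u (fun t => B t (u t))).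

(** The function u(t) - t B(b)u(a) has derivative (B(t) - B(b))u(t) + B(b)(u(t) - u(a)). The
    Lipschitz condition makes the first term O(b-a), the mean value inequality for [u] the second; a
    further mean value inequality gives the square. *)
Lemma euler_step_error : exists2 C, 0 <= C & forall a b, s <= a -> a <= b -> b <= T ->
  nrm (u b - (u a + (b - a)%:C *: B b (u a))) <= C * (b - a) ^+ 2.
Proof.
have [C C0 hC] := has_deriv_bounded sT derU.
exists (Lip * C + M * (M * C)); first by rewrite addr_ge0 ?mulr_ge0.
move=> a b sa ab bT.
have -> : u b - (u a + (b - a)%:C *: B b (u a)) =
  (u b - b%:C *: B b (u a)) - (u a - a%:C *: B b (u a)).
  by rewrite rmorphB/= scalerBl !opprD addrA [RHS]addrACA !addrA opprK.
rewrite expr2 [leRHS]mulrA.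
have sub x y : a <= x -> y <= b -> has_deriv x y u (fun t => B t (u t)).
  by move=> ax yb; apply: has_deriv_sub derU; rewrite ?(le_trans sa)// (le_trans yb).
apply: (mean_value_ineq (f := fun t => u t - t%:C *: B b (u a)) ab
  (has_deriv_subZ (B b (u a)) (sub a b (lexx _) (lexx _)))).
move=> x /andP[ax xb].
have xsT : s <= x <= T by rewrite (le_trans sa)//= (le_trans xb).
have bsT : s <= b <= T by rewrite bT (le_trans sa).
apply: (le_trans (nrm_sub_triangle _ (B b (u x)) _)); rewrite mulrDl lerD//.
  apply: (le_trans (lipB _ _ _)) => //; rewrite mulrAC.
  have xb' : `|x - b| <= b - a by rewrite ler0_norm ?subr_le0//; lra.
  by apply: ler_pM; rewrite ?mulr_ge0 ?nrm_ge0// ler_wpM2l// hC.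
(* Written as a first iterate so that [iter_sub] supplies additivity of [B b]. *)
rewrite [_ - _](_ : _ = iter 1 (B b) (u x - u a)); last by rewrite iter_sub.
apply: (le_trans (leB _ _)) => //; rewrite -mulrA ler_wpM2l//.
apply: (@le_trans _ _ (M * C * (x - a))).
  apply: (mean_value_ineq ax (sub _ _ (lexx _) xb)) => y /andP[ay yx].
  have ysT : s <= y <= T by rewrite (le_trans sa)//= (le_trans yx)// (le_trans xb).
  by apply: (le_trans (leB _ _)) => //; rewrite ler_wpM2l// hC.
by rewrite ler_wpM2l ?mulr_ge0//; lra.
Qed.

(** Each step of length [h] adds an error of at most [D * h ^+ 2] and multiplies the previous one by
    at most [expR (M * h)]. Since [m * h = T - s], the amplification stays bounded and the sum is
    O(1/m). *)
Lemma discretisation_error : exists2 K, 0 <= K & forall m : nat, (0 < m)%N ->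
  nrm (time_discretisation B m T s (u s) - u T) <= K / m%:R.
Proof.
have [C C0 hC] := euler_step_error.
have [Cu Cu0 hCu] := has_deriv_bounded sT derU.
pose X := M * (T - s).
have Ts : 0 <= T - s by rewrite subr_ge0.
have X0 : 0 <= X by rewrite mulr_ge0.
(* [C] accounts for the Euler step, the other summand for the Taylor remainder of the exponential,
   where [h <= T - s] bounds [expR (M * h)] by [expR X]. *)
pose D := C + M ^+ 2 * expR X * Cu.
have D0 : 0 <= D by rewrite addr_ge0 ?mulr_ge0 ?expR_ge0 ?exprn_ge0.
exists (expR X * D * (T - s) ^+ 2).
  by rewrite !mulr_ge0 ?expR_ge0 ?exprn_ge0.
move=> m m0; rewrite /time_discretisation.
have mR : (0 : R) < m%:R by rewrite ltr0n.
set h := (T - s) / m%:R.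
have h0 : 0 <= h by rewrite divr_ge0 ?ler0n.
have hm : m%:R * h = T - s by rewrite mulrC divfK ?gt_eqF.
have main k : (k <= m)%N ->
  nrm (foldl (fun v k => exp_op (fun w => h%:C *: B (s + k%:R * h) w) v) (u s)
         (iota 1 k) - u (s + k%:R * h))
  <= expR (k%:R * (M * h)) * (k%:R * (D * h ^+ 2)).
  elim: k => [_|k IH km].
    by rewrite !mul0r addr0 subrr nrm0 mulr0.
  have := IH (ltnW km); set E := foldl _ _ _ => {}IH.
  (* The list is peeled at its right end, because [foldl] applies the factor with the latest time
     last. *)
  have -> : iota 1 k.+1 = iota 1 k ++ [:: k.+1] by rewrite -(iotaD 1 k 1) addn1.
  rewrite foldl_cat /= -/E.
  have leh (i : nat) : (i <= m)%N -> s <= s + i%:R * h <= T.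
    move=> im; rewrite lerDl mulr_ge0//= -lerBrDl -hm ler_wpM2r ?ler_nat//.
  set a := s + k%:R * h in IH *; set b := s + k.+1%:R * h.
  have ba : b - a = h by rewrite /b /a -natr1; ring.
  have bT := leh _ km; have aT := leh _ (ltnW km).
  pose G w := h%:C *: B b w.
  have linG : linear G.
    move=> c v w; rewrite /G linB scalerDr; congr (_ + _).
    by rewrite !scalerA mulrC.
  have leG w : nrm (G w) <= M * h * nrm w.
    by rewrite /G nrmZ ger0_norm// [M * h]mulrC -[leRHS]mulrA ler_wpM2l// leB.
  have cvG v := @cvB _ h v bT.
  have Mh0 : 0 <= M * h by rewrite mulr_ge0.
  have hTs : h <= T - s.
    by rewrite -hm -[leLHS]mul1r ler_wpM2r// ler1n.
  have step : nrm (exp_op G (u a) - u b) <= D * h ^+ 2.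
    apply: (le_trans (nrm_sub_triangle _ (u a + G (u a)) _)).
    rewrite mulrDl addrC lerD//.
      rewrite -nrmN opprB /G -ba.
      by apply: hC; [have /andP[] := aT| rewrite -subr_ge0 ba|have /andP[] := bT].
     apply: (le_trans (nrm_exp_taylor Mh0 leG cvG _)).
    have -> : M ^+ 2 * expR X * Cu * h ^+ 2 = (M * h) ^+ 2 * expR X * Cu by ring.
    apply: ler_pM; rewrite ?nrm_ge0 ?mulr_ge0 ?expR_ge0 ?exprn_ge0//.
      by rewrite ler_wpM2l ?exprn_ge0// ler_expR ler_wpM2l.
    exact: hCu.
  rewrite -natr1 (mulrDl _ _ (M * h)) (mulrDl _ _ (D * h ^+ 2)) !mul1r expRD.
  (* The new error is the old one moved by [exp_op G], plus the local error of a step that starts on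
     the exact solution. *)
  apply: (le_trans (nrm_sub_triangle _ (exp_op G (u a)) _)).
  rewrite [leRHS]mulrDr lerD//.
    rewrite -exp_op_sub//.
    apply: (le_trans (nrm_exp_le Mh0 leG cvG _)).
    by rewrite [_ * expR _]mulrC -mulrA ler_wpM2l ?expR_ge0.
  (* The fresh local error is multiplied by an exponential that is at least 1, to fit the form of
     the induction hypothesis. *)
  apply: (le_trans step); rewrite ler_peMl ?mulr_ge0 ?exprn_ge0//.
  by rewrite -expRD -expR0 ler_expR addr_ge0// mulr_ge0.
have := main m (leqnn m).
rewrite hm subrKC (mulrCA _ M h) hm -/X => /le_trans; apply.
rewrite -!mulrA ler_wpM2l ?expR_ge0//.
rewrite mulrCA ler_wpM2l// /h le_eqVlt; apply/orP; left; apply/eqP.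
by field; rewrite gt_eqF.
Qed.

End Discretisation.

(** * Convergence of the exponential series *)

Section FiniteSpan.
Variables (R : realType) (H : normedModType R[i]).

Lemma cvg_real_scale (x : nat -> R) (l : R) (v : H) : x @ \oo --> l ->
  (fun n => (x n)%:C *: v) @ \oo --> l%:C *: v.
Proof.
move=> xl; apply/cvgrPdist_lt => e e0.
(* A positive element of [R[i]] is real. *)
have eE : e = (complex.Re e)%:C.
  by move: e0; case: e => a b; rewrite ltcE /= => /andP[/eqP -> _].
move: e0; rewrite eE ltcR; set d := complex.Re e => d0.
have v1 : 0 < nrm v + 1 by rewrite ltr_wpDl ?nrm_ge0.
have /cvgrPdist_lt/(_ _ (divr_gt0 d0 v1)) h := xl.
near=> n; rewrite ltc_nrm -scalerBl -rmorphB/= nrmZ.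
apply: (@le_lt_trans _ _ (`|l - x n| * (nrm v + 1))).
  by rewrite ler_wpM2l// lerDl.
by rewrite -ltr_pdivlMr//; near: n.
Unshelve. all: by end_near. Qed.

(** The limit is found in the scalars: real and imaginary parts of the coefficients form series in
    the complete field [R], dominated by [C] times the series of [expR x], and are then multiplied
    into the fixed vectors [v] and ['i *: v]. *)
Lemma complex_exp_series_cvg (a : nat -> R[i]) (v : H) (C x : R) :
  0 <= C -> 0 <= x -> (forall k, Normc.normc (a k) <= C * x ^+ k) ->
  cvgn (series (fun k => ((k`!%:R^-1 : R[i]) * a k) *: v)).
Proof.
move=> C0 x0 aC.
have cv (b : nat -> R) : (forall k, `|b k| <= C * x ^+ k) ->
    cvgn (series (fun k => (k`!%:R^-1 * b k) : R)).
  move=> bC; apply: normed_cvg.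
  apply: (@series_le_cvg _ _ (C *: exp_coeff x)).
  - by move=> k; exact: normr_ge0.
  - by move=> k; exact: (mulr_ge0 C0 (exp_coeff_ge0 _ x0)).
  - move=> k; change (`|k`!%:R^-1 * b k| <= C * (x ^+ k / k`!%:R)).
    rewrite normrM ger0_norm ?invr_ge0// mulrC [leRHS]mulrA.
    by rewrite ler_wpM2r ?invr_ge0.
  exact/is_cvg_seriesZ/is_cvg_series_exp_coeff.
have [cr ci] : cvgn (series (fun k => (k`!%:R^-1 * complex.Re (a k)) : R)) /\
    cvgn (series (fun k => (k`!%:R^-1 * complex.Im (a k)) : R)).
  split; apply: cv => k; apply: le_trans (aC k); rewrite normcE2.
    by rewrite -sqrtr_sqr ler_wsqrtr// lerDl sqr_ge0.
  by rewrite -sqrtr_sqr ler_wsqrtr// lerDr sqr_ge0.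
pose re n := series (fun k => (k`!%:R^-1 * complex.Re (a k)) : R) n.
pose im n := series (fun k => (k`!%:R^-1 * complex.Im (a k)) : R) n.
suff -> : series (fun k => ((k`!%:R^-1 : R[i]) * a k) *: v) =
    (fun n => (re n)%:C *: v) + (fun n => (im n)%:C *: ('i *: v)).
  by apply: (cvgP _ (cvgD (cvg_real_scale (v := v) cr)
    (cvg_real_scale (v := 'i *: v) ci))).
apply/funext => n.
rewrite fctE /re /im /series/= !rmorph_sum/= !scaler_suml -big_split/=.
apply: eq_bigr => k _.
rewrite scalerA -scalerDl; congr (_ *: _).
rewrite !rmorphM/= fmorphV/= rmorph_nat -mulrA -mulrDr; congr (_ * _).
by rewrite [LHS]complexE [in RHS]mulrC.
Qed.

(** On the span of the [e j] the iterates of [G] are those of a matrix, so the series is a finite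
    sum of scalar series times fixed vectors. The [e j] may be linearly dependent; [a k] is one
    choice of coordinates. *)
Lemma exp_series_cvg (J : finType) (e : J -> H) (G : H -> H)
    (M : J -> J -> R[i]) (c : J -> R[i]) : linear G ->
  (forall i, G (e i) = \sum_j M i j *: e j) ->
  cvgn (series (fun k => (k`!%:R^-1 : R[i]) *: iter k G (\sum_j c j *: e j))).
Proof.
move=> linG Ge.
pose a k := iter k (fun b j => \sum_i b i * M i j) c.
have G_sum (b : J -> R[i]) : G (\sum_j b j *: e j) = \sum_j b j *: G (e j).
  have G0 : G 0 = 0.
    by have := linG (-1) 0 0; rewrite scaler0 add0r scaleN1r addNr.
  elim/big_rec2: _ => [//|i x y _ <-]; exact: linG.
have iterE k : iter k G (\sum_j c j *: e j) = \sum_j a k j *: e j.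
  elim: k => [//|k IH]; rewrite iterS IH G_sum.
  under eq_bigr do rewrite Ge scaler_sumr.
  rewrite exchange_big/=; apply: eq_bigr => j _.
  by rewrite scaler_suml; apply: eq_bigr => i _; rewrite scalerA.
(* [S] dominates every column sum of [M], so each iteration enlarges the coordinates by a factor of
   at most [S]. *)
pose S := \sum_j \sum_i Normc.normc (M i j).
pose C := \sum_j Normc.normc (c j).
have S0 : 0 <= S by do 2![apply: sumr_ge0 => ? _]; exact: normc_ge0.
have C0 : 0 <= C by apply: sumr_ge0 => ? _; exact: normc_ge0.
have aC k j : Normc.normc (a k j) <= C * S ^+ k.
  elim: k j => [|k IH] j.
    rewrite mulr1 /C (bigD1 j)//= lerDl; apply: sumr_ge0 => ? _; exact: normc_ge0.
  rewrite /a iterS -/(a k).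
  apply: (@le_trans _ _ (\sum_i Normc.normc (a k i * M i j))).
    elim/big_rec2: _ => [|i x y _ h]; first by rewrite Normc.normc0.
    by apply: (le_trans (normcD _ _)); rewrite lerD2l.
  apply: (@le_trans _ _ (\sum_i C * S ^+ k * Normc.normc (M i j))).
    by apply: ler_sum => i _; rewrite Normc.normcM ler_wpM2r ?normc_ge0.
  rewrite -mulr_sumr exprSr mulrA ler_wpM2l ?mulr_ge0 ?exprn_ge0//.
  rewrite /S [leRHS](bigD1 j)//= lerDl.
  by do 2![apply: sumr_ge0 => ? _]; exact: normc_ge0.
pose f j k := ((k`!%:R^-1 : R[i]) * a k j) *: e j.
have fcv j : cvgn (series (f j)).
  exact: (complex_exp_series_cvg (v := e j) C0 S0 (fun k => aC k j)).
(* The sum over [J] is taken along a list so that convergence follows by induction. *)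
rewrite (_ : series _ = (fun n => \sum_(j <- enum J) series (f j) n)).
  elim: (enum J) => [|j r IH].
    by under eq_fun do rewrite big_nil; exact: is_cvg_cst.
  by under eq_fun do rewrite big_cons; exact: is_cvgD.
apply/funext => n; rewrite big_enum/= exchange_big/=; apply: eq_bigr => k _.
by rewrite iterE scaler_sumr; apply: eq_bigr => j _; rewrite scalerA.
Qed.
End FiniteSpan.

(** * Real-analytic functions are Lipschitz *)

(** These weights appear when a power series is differentiated termwise at half the radius. *)
Lemma geometric_weight_sum (R : realType) n :
  \sum_(0 <= k < n) k%:R / 2 ^+ k <= (2 : R).
Proof.
suff -> : \sum_(0 <= k < n) k%:R / 2 ^+ k = 2 - 2 * n.+1%:R / 2 ^+ n :> R.
  by rewrite lerBlDr lerDl divr_ge0// mulr_ge0.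
elim: n => [|n IH]; first by rewrite big_geq// expr0 divr1 mulr1 subrr.
rewrite big_nat_recr//= IH exprS -!natr1.
have h : (2 : R) ^+ n != 0 by rewrite expf_neq0.
by field.
Qed.

(* Multiplied by [h] so that the predecessor of [k] does not occur. *)
Lemma dist_expr_le (R : realType) (p q h : R) k : `|p| <= h -> `|q| <= h ->
  h * `|p ^+ k - q ^+ k| <= k%:R * h ^+ k * `|p - q|.
Proof.
move=> ph qh; have h0 : 0 <= h by apply: le_trans ph.
elim: k => [|k IH]; first by rewrite subrr normr0 !mul0r mulr0.
have -> : p ^+ k.+1 - q ^+ k.+1 = p * (p ^+ k - q ^+ k) + q ^+ k * (p - q).
  by rewrite !exprS; ring.
apply: (@le_trans _ _ (h * (h * `|p ^+ k - q ^+ k| + h ^+ k * `|p - q|))).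
  rewrite ler_wpM2l// (le_trans (ler_normD _ _))// !normrM normrX.
  by apply: lerD; rewrite ler_wpM2r// lerXn2r// nnegrE.
have -> : k.+1%:R * h ^+ k.+1 * `|p - q| =
    h * (k%:R * h ^+ k * `|p - q| + h ^+ k * `|p - q|).
  by rewrite -natr1 exprS; ring.
by rewrite ler_wpM2l// lerD2r.
Qed.

(** Convergence at [rho] bounds the terms by some [M]. At half the radius, [h] times the difference
    of the k-th terms is then at most [k / 2 ^ k * M * |p - q|], and the weights sum to at most 2;
    hence the constant [2 * M / h]. *)
Lemma power_series_lipschitz (R : realType) (a : nat -> R) (rho : R) :
  0 < rho -> cvgn (series (fun k => a k * rho ^+ k)) ->
  exists2 C, 0 <= C & forall p q f g, `|p| <= rho / 2 -> `|q| <= rho / 2 ->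
    series (fun k => a k * p ^+ k) @ \oo --> f ->
    series (fun k => a k * q ^+ k) @ \oo --> g -> `|f - g| <= C * `|p - q|.
Proof.
move=> rho0 cv.
have [M M0 hM] : exists2 M, 0 <= M & forall k, `|a k * rho ^+ k| <= M.
  have /cvgP/cvg_seq_bounded[M [_ hM]] := cvg_series_cvg_0 cv.
  exists (`|M| + 1); first by rewrite addr_ge0.
  move=> k; apply: hM => //.
  by rewrite (le_lt_trans (ler_norm _))// ltrDl.
pose h := rho / 2; have h0 : 0 < h by rewrite divr_gt0.
exists (2 * M / h); first by rewrite divr_ge0 ?mulr_ge0// ltW.
move=> p q f g ph qh pf qg.
apply: (cvgr_to_le (cvg_norm (cvgB pf qg))).
near=> n; rewrite /= mulrAC ler_pdivlMr// mulrC.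
rewrite fctE /series/= -sumrB.
apply: (@le_trans _ _ (h * \sum_(0 <= k < n) `|a k * p ^+ k - a k * q ^+ k|)).
  by rewrite ler_wpM2l ?(ltW h0)// ler_norm_sum.
rewrite mulr_sumr.
apply: (@le_trans _ _ (\sum_(0 <= k < n) k%:R / 2 ^+ k * (M * `|p - q|))).
  apply: ler_sum => k _.
  rewrite -mulrBr normrM mulrCA.
  apply: (le_trans (ler_wpM2l (normr_ge0 _) (dist_expr_le k ph qh))).
  have -> : `|a k| * (k%:R * h ^+ k * `|p - q|) =
      k%:R / 2 ^+ k * (`|a k * rho ^+ k| * `|p - q|).
    rewrite normrM (ger0_norm (exprn_ge0 _ (ltW rho0))) /h expr_div_n.
    by field; rewrite expf_neq0.
  by rewrite ler_wpM2l ?divr_ge0 ?exprn_ge0// ler_wpM2r.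
by rewrite -mulr_suml -mulrA ler_wpM2r ?mulr_ge0// geometric_weight_sum.
Unshelve. all: by end_near. Qed.

Lemma analytic_lipschitz (R : realType) (f : R -> R) (s T : R) :
  0 <= s -> s <= T -> analytic_on [set t | 0 <= t] f ->
  exists2 C, 0 <= C & forall x y, s <= x <= T -> s <= y <= T ->
    `|f x - f y| <= C * `|x - y|.
Proof.
move=> s0 sT fan.
(* Ordered pairs suit the gluing of intervals: a pair that straddles the common end point is split
   there. *)
suff [C C0 hC] : exists2 C, 0 <= C & forall x y, s <= x -> x <= y -> y <= T ->
    `|f x - f y| <= C * `|x - y|.
  exists C => // x y /andP[sx xT] /andP[sy yT]; have [xy|/ltW yx] := leP x y.
    exact: hC.
  by rewrite distrC [`|x - y|]distrC; exact: hC.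
apply: (@interval_cousin _ (fun u v => exists2 C, 0 <= C &
    forall x y, u <= x -> x <= y -> y <= v -> `|f x - f y| <= C * `|x - y|)) => //.
  move=> u v w _ _ [C C0 hC] [D D0 hD]; exists (C + D); first exact: addr_ge0.
  move=> x y ux xy yw; rewrite mulrDl.
  have [yv|/ltW vy] := leP y v.
    by apply: (le_trans (hC _ _ ux xy yv)); rewrite lerDl mulr_ge0.
  have [vx|/ltW xv] := leP v x.
    by apply: (le_trans (hD _ _ vx xy yw)); rewrite lerDr mulr_ge0.
  apply: (le_trans (ler_distD (f v) _ _)); apply: lerD.
    apply: (le_trans (hC x v ux xv (lexx _))); rewrite ler_wpM2l//.
    by rewrite !ler0_norm ?subr_le0//; lra.
  apply: (le_trans (hD v y (lexx _) vy yw)); rewrite ler_wpM2l//.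
  by rewrite !ler0_norm ?subr_le0//; lra.
move=> x /andP[sx xT]; have x0 : 0 <= x by apply: le_trans sx.
have [a [r [r0 har]]] := fan x x0.
have rho0 : 0 < r / 2 by rewrite divr_gt0.
(* The point [x + r / 2] lies in the domain even for [x = 0], so the expansion converges there; the
   Lipschitz estimate then covers radius [r / 4]. *)
have cv : cvgn (series (fun k => a k * (r / 2) ^+ k)).
  have /= := har (x + r / 2); rewrite [x + _]addrC addrK => /(_ _ _)/cvgP; apply.
    by rewrite addr_ge0// ltW.
  by rewrite gtr0_norm//; lra.
have [C C0 hC] := power_series_lipschitz rho0 cv.
exists (r / 2 / 2); first by rewrite !divr_gt0.
move=> u v /andP[su ux] /andP[xv vT] vu; exists C => // y z uy yz zv.
have near_x w : u <= w -> w <= v -> `|w - x| <= r / 2 / 2.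
  by move=> uw wv; rewrite ler_norml; lra.
have dom w : u <= w -> w <= v ->
    series (fun k => a k * (w - x) ^+ k) @ \oo --> f w.
  move=> uw wv; apply: har => /=; first by rewrite (le_trans s0)// (le_trans su).
  by apply: (le_lt_trans (near_x w uw wv)); lra.
have := hC (y - x) (z - x) (f y) (f z) (near_x _ uy (le_trans yz zv))
  (near_x _ (le_trans uy yz) zv) (dom _ uy (le_trans yz zv))
  (dom _ (le_trans uy yz) zv).
by rewrite opprB addrA subrK.
Qed.

(** * Finite spans and operators assembled from blocks *)

Section LinearSpan.
Variables (R : realType) (H : normedModType R[i]) (J : finType) (e : J -> H).

Definition in_span (v : H) := exists m : J -> R[i], v = \sum_j m j *: e j.

Lemma in_spanD u v : in_span u -> in_span v -> in_span (u + v).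
Proof.
move=> [a ->] [b ->]; exists (fun j => a j + b j).
by rewrite -big_split/=; apply: eq_bigr => j _; rewrite scalerDl.
Qed.

Lemma in_spanZ c u : in_span u -> in_span (c *: u).
Proof.
move=> [a ->]; exists (fun j => c * a j).
by rewrite scaler_sumr; apply: eq_bigr => j _; rewrite scalerA.
Qed.

Lemma in_span0 : in_span 0.
Proof. by exists (fun=> 0); rewrite big1// => j _; rewrite scale0r. Qed.

Lemma in_span_sum (I : Type) (r : seq I) (F : I -> H) :
  (forall i, in_span (F i)) -> in_span (\sum_(i <- r) F i).
Proof.
by move=> h; apply: big_ind => //; [exact: in_span0|exact: in_spanD].
Qed.

Lemma in_span_gen j : in_span (e j).
Proof.
exists (fun i => (i == j)%:R); rewrite (bigD1 j)//= eqxx scale1r big1 ?addr0//.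
by move=> i /negPf ->; rewrite scale0r.
Qed.

End LinearSpan.

(* The [P i] are the restrictions to the balls, the [w i] their indicators and
   the [al i] the integrals over them. *)
Section BlockOperator.
Variables (R : realType) (H : normedModType R[i]) (n : nat).
Variables (P : 'I_n -> H -> H) (w : 'I_n -> H) (al : 'I_n -> H -> R[i]).
Variables (q : R[i]) (c : R).
Hypotheses (c0 : 0 <= c) (linP : forall i, linear (P i))
  (leP : forall i u, nrm (P i u) <= nrm u)
  (PP : forall i j u, P i (P j u) = if i == j then P i u else 0)
  (Pw : forall i j, P i (w j) = if i == j then w i else 0)
  (linal : forall i a u v, al i (a *: u + v) = a * al i u + al i v)
  (leal : forall i u, Normc.normc (al i u) <= c * nrm u).

(** The shape of the p-adic Laplacian, with [q] standing for p^N: a finite-rank integral operator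
    minus a combination of projections. *)
Definition block_op (A : 'M[R]_n) (u : H) : H :=
  \sum_i (\sum_j (A i j)%:C * (q * al j u)) *: w i
  - \sum_i (degree A i)%:C *: P i u.

Lemma block_op_linear A : linear (block_op A).
Proof.
move=> a u v; rewrite /block_op scalerBr addrACA -opprD.
congr (_ - _).
  rewrite scaler_sumr -big_split/=; apply: eq_bigr => i _.
  rewrite scalerA -scalerDl mulr_sumr -big_split/=; congr (_ *: _).
  by apply: eq_bigr => j _; rewrite linal; ring.
rewrite scaler_sumr -big_split/=; apply: eq_bigr => i _.
by rewrite linP scalerDr !scalerA mulrC.
Qed.

(** Linearity in the matrix turns the operator bound into Lipschitz dependence on the matrix
    entries. *)
Lemma block_opB A A' u : block_op A u - block_op A' u = block_op (A - A') u.
Proof.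
rewrite /block_op opprB [X in _ + X = _]addrC addrACA.
rewrite [X in _ + X = _]addrC -[X in _ + X = _]opprB.
rewrite [X in _ - X](_ : _ = \sum_i (degree (A - A') i)%:C *: P i u); last first.
  rewrite -sumrB; apply: eq_bigr => i _; rewrite -scalerBl; congr (_ *: _).
  rewrite -rmorphB/=; congr (_%:C); rewrite /degree -sumrB.
  by apply: eq_bigr => j _; rewrite !mxE.
congr (_ - _); rewrite -sumrB; apply: eq_bigr => i _; rewrite -scalerBl.
congr (_ *: _); rewrite -sumrB; apply: eq_bigr => j _.
by rewrite !mxE rmorphB/=; ring.
Qed.

Definition entries_norm (A : 'M[R]_n) := \sum_i \sum_j `|A i j|.

Lemma block_op_bound : exists2 K, 0 <= K &
  forall A u, nrm (block_op A u) <= K * entries_norm A * nrm u.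
Proof.
pose W := \sum_i nrm (w i).
have W0 : 0 <= W by apply: sumr_ge0 => i _; exact: nrm_ge0.
(* The product bounds the finite-rank part. The [1] bounds the degree part, as the [P i] are
   contractions and the degrees add up to at most [entries_norm A] in absolute value. *)
exists (Normc.normc q * c * W + 1).
  by rewrite addr_ge0// !mulr_ge0// normc_ge0.
move=> A u; apply: (le_trans (nrmD _ _)); rewrite nrmN !mulrDl mul1r lerD//.
  apply: (le_trans (nrm_sum _ _)).
  pose X := Normc.normc q * (c * nrm u).
  have X0 : 0 <= X by rewrite !mulr_ge0 ?normc_ge0 ?nrm_ge0.
  have -> : Normc.normc q * c * W * entries_norm A * nrm u =
    \sum_i entries_norm A * X * nrm (w i).
    by rewrite -mulr_sumr /X -/W; ring.
  apply: ler_sum => i _; rewrite nrmZc ler_wpM2r ?nrm_ge0//.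
  apply: (@le_trans _ _ (\sum_j `|A i j| * X)).
    apply: (big_ind2 (fun (x : R[i]) y => Normc.normc x <= y)).
    - by rewrite Normc.normc0.
    - by move=> x x' y y' h h'; apply: (le_trans (normcD _ _)); exact: lerD.
    move=> j _; rewrite Normc.normcM normcE2/= expr0n addr0 sqrtr_sqr.
    by rewrite ler_wpM2l// Normc.normcM ler_wpM2l ?normc_ge0.
  rewrite -mulr_suml ler_wpM2r// /entries_norm [leRHS](bigD1 i)//= lerDl.
  by do 2![apply: sumr_ge0 => ? _].
apply: (le_trans (nrm_sum _ _)); rewrite /entries_norm mulr_suml.
apply: ler_sum => i _; rewrite nrmZ; apply: ler_pM; rewrite ?nrm_ge0//.
exact: ler_norm_sum.
Qed.

Lemma block_op_exp_cvg A (a : R) u : cvgn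
  (series (fun k => (k`!%:R^-1 : R[i]) *: iter k (fun v => a%:C *: block_op A v) u)).
Proof.
(* By [PP] and [Pw], the span of [u], its blocks [P i u] and the [w i] is stable under the
   operator. *)
pose e (x : option ('I_n + 'I_n)) :=
  match x with None => u | Some (inl i) => P i u | Some (inr i) => w i end.
have spanP i x : in_span e (P i (e x)).
  case: x => [[k|k]|] /=.
  - by rewrite PP; case: eqP => _; [exact: (in_span_gen e (Some (inl i)))|exact: in_span0].
  - by rewrite Pw; case: eqP => _; [exact: (in_span_gen e (Some (inr i)))|exact: in_span0].
  - exact: (in_span_gen e (Some (inl i))).
have spanG x : in_span e (a%:C *: block_op A (e x)).
  apply/in_spanZ/in_spanD.
    by apply: in_span_sum => i; apply: in_spanZ; exact: (in_span_gen e (Some (inr i))).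
  rewrite -scaleN1r; apply/in_spanZ/in_span_sum => i; exact/in_spanZ/spanP.
have [M hM] := choice spanG.
have [m um] : exists m, u = \sum_j m j *: e j := in_span_gen e None.
rewrite um.
have linG : linear (fun v => a%:C *: block_op A v).
  by move=> b v v'; rewrite block_op_linear scalerDr !scalerA mulrC.
exact: (exp_series_cvg (c := m) linG hM).
Qed.

End BlockOperator.

(** * Square-integrable functions *)

Section L2Facts.
Context d (T : measurableType d) (R : realType) (mu : {measure set T -> \bar R}).

Local Notation N2 f := ('N[mu]_2%:E[EFin \o f])%E.

(** The representative chosen by [L2repr] differs from [f] on a null set only. *)
Lemma L2norm_class (f : L2fun mu) :
  (L2norm (L2class f))%:E = N2 (fun x => Normc.normc (f x)).
Proof.
have mf (g : L2fun mu) : measurable_fun setT (fun x => Normc.normc (g x)).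
  by apply: measurable_normc; have /L2predP[] := L2funP g.
rewrite /L2norm fineK; last first.
  rewrite fin_numElt (lt_le_trans ltNy0) ?Lnorm_ge0//=.
  by have /L2predP[] := L2funP (L2repr (L2class f)).
rewrite unlock /Lnorm; congr (_ `^ _)%E.
have mp (k : L2fun mu) :
    measurable_fun setT (fun x : T => (`|(Normc.normc (k x))%:E| `^ 2)%E).
  apply: (measurableT_comp (measurable_poweR 2)).
  by apply: measurableT_comp => //; exact/measurable_EFinP/mf.
apply: ae_eq_integral; [exact: measurableT|exact: mp|exact: mp|].
by apply: filterS (L2reprP f) => x e _ /=; rewrite e.
Qed.

Lemma L2norm_repr (u : L2 mu) :
  (L2norm u)%:E = N2 (fun x => Normc.normc (L2repr u x)).
Proof. by rewrite -[u in LHS]L2reprK L2norm_class. Qed.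

Lemma L2repr_linear a (u v : L2 mu) : {ae mu, forall x,
  L2repr (a *: u + v) x = a * L2repr u x + L2repr v x}.
Proof.
have -> : a *: u + v = L2class (a *: L2repr u + L2repr v).
  by rewrite L2classD L2classZ !L2reprK.
exact: L2reprP.
Qed.

Lemma L2fun_sumE (I : Type) (r : seq I) (F : I -> L2fun mu) x :
  (\sum_(i <- r) F i) x = \sum_(i <- r) F i x.
Proof. by elim/big_rec2: _ => // i y z _ <-. Qed.

Lemma L2class_sum (I : Type) (r : seq I) (F : I -> L2fun mu) :
  L2class (\sum_(i <- r) F i) = \sum_(i <- r) L2class (F i).
Proof.
elim/big_rec2: _ => [|i y z _ <-]; [exact: L2class0|exact: L2classD].
Qed.

Lemma L2class_everywhere (f g : L2fun mu) : (forall x, f x = g x) ->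
  L2class f = L2class g.
Proof. by move=> fg; apply/L2class_eq/nearW. Qed.

Hypothesis mu_fin : (mu setT < +oo)%E.

Lemma Lnorm2_integrable (f : T -> R) : measurable_fun setT f ->
  (N2 f < +oo)%E -> mu.-integrable setT (EFin \o f).
Proof.
move=> mf ff; apply/Lfun1_integrable/Lfun_subset12.
  by rewrite ge0_fin_numE.
by apply/andP; split; apply/mem_set.
Qed.

(** Enlarge [D] to the whole space and apply the Cauchy-Schwarz inequality with the constant
    function 1, whose norm is the square root of the total mass. *)
Lemma normr_Rintegral_le (D : set T) (f : T -> R) : measurable D ->
  measurable_fun setT f -> (N2 f < +oo)%E ->
  (`|\int[mu]_(x in D) f x|%:E <= N2 f * mu setT `^ 2^-1)%E.
Proof.
move=> mD mf ff; have intf := Lnorm2_integrable mf ff.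
have intD : mu.-integrable D (EFin \o f).
  by apply: integrableS intf.
have /integrableP[mDf _] := intD.
rewrite EFin_normr_Rintegral//.
apply: (le_trans (le_abse_integral mu mD mDf)).
apply: (@le_trans _ _ (\int[mu]_x `|(f x)%:E|)%E).
  apply: ge0_subset_integral => //.
  by apply: measurableT_comp => //; exact/measurable_EFinP.
have m1 : measurable_fun setT (cst 1 : T -> R) by exact: measurable_cst.
have half : (2 : R)^-1 + 2^-1 = 1 by lra.
have := hoelder mu mf m1 (ltr0Sn _ 1) (ltr0Sn _ 1) half.
rewrite Lnorm1 Lnorm_cst1 => /(le_trans _); apply.
apply: ge0_le_integral => //.
- by apply: measurableT_comp => //; exact/measurable_EFinP.
- apply: measurableT_comp => //; apply/measurable_EFinP.
  exact: measurable_funM.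
- by move=> x _; rewrite /= mulr1.
Qed.

(** The analogue of [cintegral] for an arbitrary measure, here to be applied to [muK]. *)
Definition cint (D : set T) (f : T -> R[i]) : R[i] :=
  (\int[mu]_(x in D) complex.Re (f x))%R +i* (\int[mu]_(x in D) complex.Im (f x))%R.

Lemma L2pred_Re f : f \in L2pred mu ->
  measurable_fun setT (@complex.Re R \o f) /\
  (N2 (@complex.Re R \o f) <= N2 (fun x => Normc.normc (f x)))%E.
Proof.
move=> /L2predP[[mr mi] _]; split => //.
apply: le_Lnorm2 => //; first exact: measurable_normc.
move=> x /=; rewrite (ger0_norm (normc_ge0 _)) normcE2 -sqrtr_sqr.
by rewrite ler_wsqrtr// lerDl sqr_ge0.
Qed.

Lemma L2pred_Im f : f \in L2pred mu ->
  measurable_fun setT (@complex.Im R \o f) /\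
  (N2 (@complex.Im R \o f) <= N2 (fun x => Normc.normc (f x)))%E.
Proof.
move=> /L2predP[[mr mi] _]; split => //.
apply: le_Lnorm2 => //; first exact: measurable_normc.
move=> x /=; rewrite (ger0_norm (normc_ge0 _)) normcE2 -sqrtr_sqr.
by rewrite ler_wsqrtr// lerDr sqr_ge0.
Qed.

Lemma L2pred_integrable D f : measurable D -> f \in L2pred mu ->
  mu.-integrable D (EFin \o (@complex.Re R \o f)) /\
  mu.-integrable D (EFin \o (@complex.Im R \o f)).
Proof.
move=> mD fL; have /L2predP[_ foo] := fL.
have [mr lr] := L2pred_Re fL; have [mi li] := L2pred_Im fL.
split; apply: (@integrableS _ _ _ _ setT) => //.
  exact: Lnorm2_integrable mr (le_lt_trans lr foo).
exact: Lnorm2_integrable mi (le_lt_trans li foo).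
Qed.

Lemma cint_linear D a f g : measurable D -> f \in L2pred mu -> g \in L2pred mu ->
  cint D (fun x => a * f x + g x) = a * cint D f + cint D g.
Proof.
move=> mD fL gL.
have [fr fi] := L2pred_integrable mD fL; have [gr gi] := L2pred_integrable mD gL.
have iZ (r : R) (h : T -> R) : mu.-integrable D (EFin \o h) ->
    mu.-integrable D (EFin \o (fun x => r * h x)).
  by move=> ih; exact: (integrableZl mD r ih).
rewrite /cint; case: a => ar ai; simpc; congr (_ +i* _).
- under eq_Rintegral do rewrite cReD cReM /=.
  rewrite RintegralD// ?RintegralB ?RintegralZl//; try exact: iZ.
  exact: (integrableB mD (iZ _ _ fr) (iZ _ _ fi)).
- under eq_Rintegral do rewrite cImD cImM /=.
  rewrite RintegralD// ?RintegralD ?RintegralZl//; try exact: iZ.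
  exact: (integrableD mD (iZ _ _ fi) (iZ _ _ fr)).
Qed.

Lemma cint_ae D f g : measurable D -> f \in L2pred mu -> g \in L2pred mu ->
  {ae mu, forall x, f x = g x} -> cint D f = cint D g.
Proof.
move=> mD /L2predP[[fr fi] _] /L2predP[[gr gi] _] fg.
rewrite /cint; congr (_ +i* _); congr fine;
  apply: ae_eq_integral => //; try (apply/measurable_EFinP; exact: measurable_funTS);
  by apply: filterS fg => x e _ /=; rewrite e.
Qed.

(** The factor 2 comes from estimating real and imaginary parts separately. *)
Lemma normc_cint_le D f : measurable D -> f \in L2pred mu ->
  ((Normc.normc (cint D f))%:E <=
   2%:E * (N2 (fun x => Normc.normc (f x)) * mu setT `^ 2^-1))%E.
Proof.
move=> mD fL; have /L2predP[_ foo] := fL.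
have [mr lr] := L2pred_Re fL; have [mi li] := L2pred_Im fL.
have hr := normr_Rintegral_le mD mr (le_lt_trans lr foo).
have hi := normr_Rintegral_le mD mi (le_lt_trans li foo).
have le_sum (z : R[i]) : Normc.normc z <= `|complex.Re z| + `|complex.Im z|.
  rewrite normcE2 -[leRHS]ger0_norm ?addr_ge0// -sqrtr_sqr ler_wsqrtr//.
  rewrite sqrrD -!normrX !(ger0_norm (sqr_ge0 _)) -addrA lerD2l lerDr.
  by rewrite mulrn_wge0// mulr_ge0.
apply: (@le_trans _ _ (`|complex.Re (cint D f)| + `|complex.Im (cint D f)|)%:E).
  by rewrite lee_fin.
rewrite (_ : 2%:E = 1 + 1)%E// ge0_muleDl// mul1e EFinD.
apply: leeD.
  by apply: (le_trans hr); apply: lee_wpmul2r => //; exact: poweR_ge0.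
by apply: (le_trans hi); apply: lee_wpmul2r => //; exact: poweR_ge0.
Qed.

End L2Facts.

(** * The p-adic Laplacian *)

Section PadicLaplacian.
Variables (p : nat) (p_pr : prime p) (R : realType) (mu : haar_measure p_pr R).
Variables (N n : nat) (V : 'I_n -> padic p_pr).

Local Notation muK := (muK mu N V).
Local Notation H := (L2K mu N V).
Local Notation Om := (Omega R N V).

Lemma muK_fin : (muK setT < +oo)%E.
Proof. by rewrite /muK/= /mrestr setTI haar_KN_fin. Qed.

(** Haar measure and its restriction agree on the measurable subsets of [KN]. *)
Lemma cintegral_muK f : cintegral mu (KN N V) f = cint muK (KN N V) f.
Proof.
rewrite /cintegral /cint; congr (_ +i* _); congr fine;
  by apply: eq_measure_integral => A mA AK; rewrite /= /mrestr setIidl.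
Qed.

Lemma cmeasurable_Omega i : cmeasurable_fun setT (Om i).
Proof.
have -> : Om i = (fun c : {ffun 'I_n -> bool} => (c i)%:R) \o ball_type N V.
  by apply/funext => x; rewrite /= ffunE.
split.
  exact: (measurable_ball_type N V (fun c => complex.Re ((c i)%:R : R[i]))).
exact: (measurable_ball_type N V (fun c => complex.Im ((c i)%:R : R[i]))).
Qed.

Lemma normc_Omega_le i x : Normc.normc (Om i x) <= 1.
Proof.
by rewrite /Omega; case: (_ \in _); rewrite ?Normc.normc1// Normc.normc0.
Qed.

Lemma Omega_L2pred i : Om i \in L2pred muK.
Proof.
exact: (L2pred_bounded muK_fin (cmeasurable_Omega i) (normc_Omega_le i)).
Qed.

Lemma Omega_mul_L2pred i f : f \in L2pred muK -> (fun x => Om i x * f x) \in L2pred muK.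
Proof.
exact: (L2pred_bounded_mul (cmeasurable_Omega i) (normc_Omega_le i)).
Qed.

Definition restr_fun i (f : L2fun muK) : L2fun muK :=
  L2Fun (Omega_mul_L2pred i (L2funP f)).

Definition ball_restr i (u : H) : H := L2class (restr_fun i (L2repr u)).

Definition ball_indic i : H := L2class (L2Fun (Omega_L2pred i)).

Definition ball_int i (u : H) : R[i] :=
  cint muK (KN N V) (restr_fun i (L2repr u)).

Lemma ball_restr_linear i : linear (ball_restr i).
Proof.
move=> a u v; rewrite /ball_restr -L2classZ -L2classD; apply/L2class_eq.
apply: filterS (L2repr_linear a u v) => x e /=.
rewrite e mulrDr.
by change (Om i x * (a * L2repr u x) + Om i x * L2repr v x =
  a * (Om i x * L2repr u x) + Om i x * L2repr v x); rewrite mulrCA.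
Qed.

Lemma restr_fun_norm_le i (f : L2fun muK) :
  ('N[muK]_2%:E[EFin \o (fun x => Normc.normc (restr_fun i f x))] <=
   'N[muK]_2%:E[EFin \o (fun x => Normc.normc (f x))])%E.
Proof.
have /L2predP[mf _] := L2funP f; have /L2predP[mr _] := L2funP (restr_fun i f).
apply: le_Lnorm2; [exact: measurable_normc|exact: measurable_normc|].
move=> x; rewrite !ger0_norm ?normc_ge0//= Normc.normcM.
by rewrite ler_piMl ?normc_ge0 ?normc_Omega_le.
Qed.

Lemma nrm_ball_restr i (u : H) : nrm (ball_restr i u) <= nrm u.
Proof.
change (L2norm (ball_restr i u) <= L2norm u).
by rewrite -lee_fin L2norm_class L2norm_repr restr_fun_norm_le.
Qed.

Lemma ball_int_linear i a (u v : H) :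
  ball_int i (a *: u + v) = a * ball_int i u + ball_int i v.
Proof.
have mK := measurable_KN N V.
rewrite /ball_int -cint_linear ?L2funP//; last exact: muK_fin.
pose g : L2fun muK := a *: restr_fun i (L2repr u) + restr_fun i (L2repr v).
apply: (cint_ae mK (L2funP _) (L2funP g)).
apply: filterS (L2repr_linear a u v) => x e /=.
rewrite e mulrDr.
by change (Om i x * (a * L2repr u x) + Om i x * L2repr v x =
  a * (Om i x * L2repr u x) + Om i x * L2repr v x); rewrite mulrCA.
Qed.

Lemma ball_int_bound : exists2 c, 0 <= c &
  forall i (u : H), Normc.normc (ball_int i u) <= c * nrm u.
Proof.
pose c := fine (muK setT `^ 2^-1)%E.
have cE : (c%:E = muK setT `^ 2^-1)%E.
  by rewrite fineK// ge0_fin_numE ?poweR_ge0// poweR_lty// muK_fin.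
exists (2 * c); first by rewrite mulr_ge0// fine_ge0// poweR_ge0.
move=> i u; change (Normc.normc (ball_int i u) <= 2 * c * L2norm u).
rewrite -lee_fin; apply: (le_trans (normc_cint_le muK_fin (measurable_KN N V) (L2funP _))).
rewrite mulrAC -mulrA [X in (_ <= X)%E]EFinM lee_wpmul2l ?lee_fin//.
rewrite EFinM cE lee_wpmul2r ?poweR_ge0//.
by rewrite L2norm_repr restr_fun_norm_le.
Qed.

Hypothesis disjV : trivIset setT (fun i => padic_ball N (V i)).

(** Disjointness of the balls makes their indicators orthogonal idempotents, whence the relations
    [PP] and [Pw] for the block operator. *)
Lemma Omega_mul i j x : Om i x * Om j x = if i == j then Om i x else 0.
Proof.
rewrite /Omega; case: eqP => [<-|/eqP ij].
  by case: (_ \in _); rewrite ?mulr1 ?mulr0.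
case: (boolP (x \in padic_ball N (V i))) => [/set_mem xi|_]; last by rewrite mul0r.
case: (boolP (x \in padic_ball N (V j))) => [/set_mem xj|_]; last by rewrite mulr0.
have /eqP := disjV I I (ex_intro _ x (conj xi xj) : _ !=set0).
by rewrite (negPf ij).
Qed.

Lemma ball_restr_restr i j (u : H) :
  ball_restr i (ball_restr j u) = if i == j then ball_restr i u else 0.
Proof.
have -> : (if i == j then ball_restr i u else 0) =
    L2class (if i == j then restr_fun i (L2repr u) else 0).
  by case: eqP => _ //; rewrite L2class0.
apply/L2class_eq; apply: filterS (L2reprP (restr_fun j (L2repr u))) => x e.
change (Om i x * L2repr (ball_restr j u) x =
  (if i == j then restr_fun i (L2repr u) else 0 : L2fun muK) x).
rewrite e /= mulrA Omega_mul.
by case: eqP => [//|_]; rewrite mul0r.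
Qed.

Lemma ball_restr_indic i j :
  ball_restr i (ball_indic j) = if i == j then ball_indic i else 0.
Proof.
have -> : (if i == j then ball_indic i else 0) =
    L2class (if i == j then L2Fun (Omega_L2pred i) else 0).
  by case: eqP => _ //; rewrite L2class0.
apply/L2class_eq; apply: filterS (L2reprP (L2Fun (Omega_L2pred j))) => x e.
change (Om i x * L2repr (ball_indic j) x =
  (if i == j then L2Fun (Omega_L2pred i) else 0 : L2fun muK) x).
rewrite e /= Omega_mul.
by case: eqP.
Qed.

(** The kernel is a finite sum of products of a function of [x] and an indicator in [y], so
    integrating over [y] leaves the ball integrals of [u] as coefficients of indicators in [x]. *)
Lemma padic_LaplacianE (A : 'M[R]_n) (u : H) : padic_Laplacian A u =
  block_op ball_restr ball_indic ball_int (p%:R ^+ N) A u.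
Proof.
set f := L2repr u.
pose b x j := p%:R ^+ N * \sum_i (A i j)%:C * Om i x.
have intE x : cintegral mu (KN N V) (fun y =>
    p%:R ^+ N * (\sum_i \sum_j (A i j)%:C * Om i x * Om j y) * f y) =
    \sum_j b x j * ball_int j u.
  rewrite cintegral_muK.
  have -> : (fun y => p%:R ^+ N * (\sum_i \sum_j (A i j)%:C * Om i x * Om j y) * f y) =
      (fun y => \sum_j b x j * restr_fun j f y).
    apply/funext => y; rewrite exchange_big/= mulr_sumr mulr_suml.
    by apply: eq_bigr => j _; rewrite /b -mulr_suml; ring.
  (* Generalised to an arbitrary list of indices for the induction; the empty case gets the integral
     of 0 from linearity. *)
  have : forall r : seq 'I_n, cint muK (KN N V) (fun y => \sum_(j <- r) b x j * restr_fun j f y)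
      = \sum_(j <- r) b x j * ball_int j u.
    elim=> [|j r IH].
      rewrite big_nil; under eq_fun do rewrite big_nil.
      pose z : L2fun muK := 0.
      have := cint_linear muK_fin (-1) (measurable_KN N V) (L2funP z) (L2funP z).
      rewrite mulN1r addNr => z0; rewrite -[RHS]z0; congr cint; apply/funext => y.
      by change (0 = -1 * 0 + 0 :> R[i]); rewrite mulr0 addr0.
    rewrite big_cons -IH; under eq_fun do rewrite big_cons.
    pose g : L2fun muK := \sum_(j <- r) b x j *: restr_fun j f.
    have gE y : \sum_(j <- r) b x j * restr_fun j f y = g y by rewrite L2fun_sumE.
    under eq_fun do rewrite gE.
    under [in RHS]eq_fun do rewrite gE.
    by rewrite (cint_linear muK_fin) ?L2funP//; exact: measurable_KN.
  exact.
rewrite /padic_Laplacian /block_op /ball_indic /ball_restr.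
under eq_bigr do rewrite -L2classZ.
under [X in _ - X]eq_bigr do rewrite -L2classZ.
rewrite -!L2class_sum -scaleN1r -L2classZ -L2classD.
apply: L2class_everywhere => x.
rewrite [LHS]/= /Laplacian_fun intE.
set F := (\sum_i _ *: L2Fun _); set G := \sum_i _ *: restr_fun _ _.
change (\sum_j b x j * ball_int j u - (\sum_i (degree A i)%:C * Om i x) * f x
  = F x + -1 * G x).
rewrite mulN1r /F /G !L2fun_sumE; congr (_ - _).
  under eq_bigr do rewrite /b mulr_sumr mulr_suml.
  rewrite exchange_big/=; apply: eq_bigr => i _.
  change (\sum_j p%:R ^+ N * ((A i j)%:C * Om i x) * ball_int j u =
    (\sum_j (A i j)%:C * (p%:R ^+ N * ball_int j u)) * Om i x).
  by rewrite mulr_suml; apply: eq_bigr => j _; ring.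
rewrite mulr_suml; apply: eq_bigr => i _.
by rewrite -mulrA.
Qed.

End PadicLaplacian.

(** * The discretisation error for the p-adic Laplacian *)

Lemma strict_solution_has_deriv (R : realType) (H : normedModType R[i])
    (B : R -> H -> H) (s T : R) (u0 : H) (u : R -> H) :
  strict_solution B s u0 u -> has_deriv s T u (fun t => B t (u t)).
Proof.
move=> [_ du _] x /andP[sx xT] e e0.
have e0' : 0 < e%:C by rewrite ltcR.
have /cvgrPdist_lt/(_ _ e0') := du x sx.
rewrite /= near_withinE near_withinE => /nbhs_ballP[d d0 hd].
exists d => // y /andP[sy yT] yx.
(* The limit of difference quotients runs over nonzero increments, so the case [y = x] is settled
   apart. *)
have [->|yx0] := eqVneq y x.
  by rewrite !subrr scale0r subr0 nrm0 normr0 mulr0.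
have hn : y - x != 0 by rewrite subr_eq0.
have yE : x + (y - x) = y by rewrite addrC subrK.
have := hd (y - x); rewrite /ball/= sub0r normrN yE => /(_ yx hn sy).
rewrite ltc_nrm; set D := u y - u x; set b := B x (u x) => h.
have -> : D - (y - x)%:C *: b = (y - x)%:C *: - (b - (y - x)^-1%:C *: D).
  by rewrite opprB scalerBr scalerA -rmorphM/= divff// scale1r.
by rewrite nrmZ nrmN mulrC ler_wpM2r// ltW.
Qed.

(** Off the diagonal [A] agrees with its Laplacian matrix; the diagonal, which cancels there, is
    covered by the last hypothesis. *)
Lemma entries_lipschitz (R : realType) (n : nat) (A : R -> 'M[R]_n) (s T : R) :
  0 <= s -> s <= T ->
  (forall i j, analytic_on [set t | 0 <= t] (fun t => graph_Laplacian (A t) i j)) ->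
  (forall i, analytic_on [set t | 0 <= t] (fun t => A t i i)) ->
  exists2 C, 0 <= C & forall x y, s <= x <= T -> s <= y <= T ->
    entries_norm (A x - A y) <= C * `|x - y|.
Proof.
move=> s0 sT LA dA.
have anA (ij : 'I_n * 'I_n) : analytic_on [set t | 0 <= t] (fun t => A t ij.1 ij.2).
  case: ij => i j /=; have [<-//|ij] := eqVneq i j.
  rewrite (_ : (fun t => A t i j) = (fun t => graph_Laplacian (A t) i j))//.
  by apply/funext => t; rewrite !mxE (negPf ij) mulr0n subr0.
have lipA ij : exists C, 0 <= C /\ forall x y, s <= x <= T -> s <= y <= T ->
    `|A x ij.1 ij.2 - A y ij.1 ij.2| <= C * `|x - y|.
  by have [C C0 hC] := analytic_lipschitz s0 sT (anA ij); exists C.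
have [C hC] := choice lipA.
exists (\sum_i \sum_j C (i, j)).
  by apply: sumr_ge0 => i _; apply: sumr_ge0 => j _; have [] := hC (i, j).
move=> x y hx hy; rewrite /entries_norm mulr_suml; apply: ler_sum => i _.
rewrite mulr_suml; apply: ler_sum => j _; rewrite !mxE.
by have [_] := hC (i, j); exact.
Qed.

Theorem corollary3p11 (R : realType) (p : nat) (p_pr : prime p)
    (mu : haar_measure p_pr R) (N n : nat) (V : 'I_n -> padic p_pr)
    (A : R -> 'M[R]_n) (U : R -> R -> L2K mu N V -> L2K mu N V) :
  is_vertex_set N V ->
  (forall t, 0 <= t -> (A t)^T = A t) ->
  (forall i j, analytic_on [set t | 0 <= t] (fun t => graph_Laplacian (A t) i j)) ->
  (forall i, analytic_on [set t | 0 <= t] (fun t => A t i i)) ->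
  evolution_family (fun t => padic_Laplacian (A t)) U ->
  forall (t s : R) (u0 : L2K mu N V), 0 <= s -> s <= t ->
    (fun m : nat => L2norm
       (time_discretisation (fun t => padic_Laplacian (A t)) m t s u0 - U t s u0))
    =O_\oo (fun m : nat => m%:R^-1 * expR m%:R^-1).
Proof.
move=> [_ _ disjV] _ LA dA evU t s u0 s0 st.
have [C C0 hC] := entries_lipschitz s0 st LA dA.
have [c c0 hc] := ball_int_bound mu N V.
have [K K0 hK] := block_op_bound (ball_indic mu N V) (p%:R ^+ N) c0
  (@nrm_ball_restr _ _ _ mu N _ V) hc.
pose Lap := fun r => padic_Laplacian (mu := mu) (N := N) (V := V) (A r).
have LapE r v : Lap r v =
    block_op (@ball_restr _ _ _ mu N _ V) (ball_indic mu N V) (@ball_int _ _ _ mu N _ V)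
      (p%:R ^+ N) (A r) v by exact: padic_LaplacianE.
(* By the Lipschitz estimate, the entries of [A r] exceed those of [A s] in total by at most
   [C * (t - s)] for [r] between [s] and [t]. *)
pose M := K * (entries_norm (A s) + C * (t - s)).
have enorm0 (X : 'M[R]_n) : 0 <= entries_norm X by do 2![apply: sumr_ge0 => ? _].
have M0 : 0 <= M by rewrite mulr_ge0 ?addr_ge0 ?mulr_ge0 ?subr_ge0.
have leLap r v : s <= r <= t -> nrm (Lap r v) <= M * nrm v.
  move=> rst; rewrite LapE; apply: (le_trans (hK _ _)).
  rewrite ler_wpM2r ?nrm_ge0// ler_wpM2l//.
  apply: (@le_trans _ _ (entries_norm (A s) + entries_norm (A r - A s))).
    rewrite /entries_norm -big_split/=; apply: ler_sum => i _.
    rewrite -big_split/=; apply: ler_sum => j _; rewrite !mxE.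
    by rewrite -{1}[A r i j](subrK (A s i j)) addrC ler_normD.
  rewrite lerD2l; apply: (le_trans (hC _ _ rst _)); first by rewrite lexx.
  have /andP[sr rt] := rst.
  by rewrite ler_wpM2l// ger0_norm ?subr_ge0// lerD2r.
have lipLap r r' v : s <= r <= t -> s <= r' <= t ->
    nrm (Lap r v - Lap r' v) <= K * C * `|r - r'| * nrm v.
  move=> hr hr'; rewrite !LapE block_opB; apply: (le_trans (hK _ _)).
  by rewrite ler_wpM2r ?nrm_ge0// -mulrA ler_wpM2l// hC.
have linLap r : linear (Lap r).
  move=> a v w; rewrite !LapE; apply: block_op_linear.
    exact: ball_restr_linear.
  exact: ball_int_linear.
have cvLap r (a : R) v : s <= r <= t -> cvgn (series
    (fun k => (k`!%:R^-1 : R[i]) *: iter k (fun w => a%:C *: Lap r w) v)).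
  move=> _; rewrite (_ : Lap r = block_op (@ball_restr _ _ _ mu N _ V)
    (ball_indic mu N V) (@ball_int _ _ _ mu N _ V) (p%:R ^+ N) (A r)).
    apply: block_op_exp_cvg.
    - exact: ball_restr_linear.
    - exact: ball_restr_restr.
    - exact: ball_restr_indic.
    - exact: ball_int_linear.
  by apply/funext => w; exact: LapE.
have [_ /(_ u0)[solU _]] := evU s s0.
have derU := strict_solution_has_deriv (T := t) solU.
have [D D0 hD] := discretisation_error st M0 (mulr_ge0 K0 C0) linLap leLap lipLap
  cvLap derU.
have Us : U s s u0 = u0 by case: solU.
rewrite Us in hD.
(* [D] may vanish, while the constant here has to be positive. *)
apply/eqO_exP; exists (D + 1); first by rewrite ltr_wpDl.
near=> m; have m0 : (0 < m)%N by near: m; exists 1%N.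
have := hD m m0; rewrite -[nrm _]/(L2norm _) => h.
have L0 : 0 <= L2norm (time_discretisation Lap m t s u0 - U t s u0) by exact: (nrm_ge0 (_ : L2K mu N V)).
rewrite (ger0_norm L0); apply: (le_trans h).
rewrite ger0_norm ?mulr_ge0 ?expR_ge0//.
(* The bound obtained is D/m, and the factor e^(1/m) is at least 1. *)
apply: ler_pM; rewrite ?invr_ge0 ?lerDl//.
by rewrite ler_peMr ?invr_ge0// -expR0 ler_expR invr_ge0.
Unshelve. all: by end_near. Qed.
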